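(* Let $G(V,E)$ be a finite simple graph with $|V|>3$. If $G(V,E)$ is minimally $3$-rigid, then for every edge $e\in E$ there exists a partition of $E$ into three pairwise disjoint sets $S_1,S_2,S_3$ (so $E=S_1\cup S_2\cup S_3$) such that $|S_i|=|V|-i$ for $i=1,2,3$ and the three graphs $G(V,S_1\cup S_2)$, $G(V,S_1\cup S_3)/e$ and $G(V,S_2\cup S_3)/e$ are all minimally $2$-rigid.
   Context: For a graph $G(V,E)$, place the vertices at points of $\mathbb{R}^d$ by a generic map $\vec{p}:V\to\mathbb{R}^d$ (e.g. with all coordinates algebraically independent over $\mathbb{Q}$), put a ball joint at each point and a rigid bar between the endpoints of each edge. $G$ is (generically) $d$-rigid if this bar-and-joint framework is rigid in $\mathbb{R}^d$; this depends only on $G$. $G$ is minimally $d$-rigid if it is $d$-rigid and has the minimal number of edges among $d$-rigid graphs on its vertex set. Equivalently (for $|V|>d$), $|E|=d|V|-\binom{d+1}{2}$ and the rigidity matrix $\vec{M}(G,d)$ has full row rank $|E|$. Here $\vec{M}(G,d)$ has one row per edge and $d|V|$ columns indexed by pairs (direction $i$, vertex); the row of an edge $v_jv_k$ has, in the block of direction $i$, entry $p_i^k-p_i^j$ in the column of $v_j$ and $p_i^j-p_i^k$ in the column of $v_k$, all other entries being zero, where $p_i^j$ is the $i$-th coordinate of $\vec{p}(v_j)$. For graphs with parallel edges the same definition is used, each parallel edge contributing its own row and being counted in $|E|$. For $S\subseteq E$, $G(V,S)$ denotes the graph with vertex set $V$ and edge set $S$. For an edge $e\in E$ with endpoints $u,v$,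 the notation $G(V,S)/e$ means: if $e\in S$, contract $e$ (delete $e$ and identify $u$ with $v$); if $e\notin S$, just identify the vertices $u$ and $v$. All other edges are kept (with multiplicity), so the result has $|V|-1$ vertices. *)

(* Defs.v *)
From mathcomp Require Import all_boot all_order all_algebra.
From mathcomp Require Import reals.
From mathcomp.multinomials Require Import mpoly.

Set Implicit Arguments.
Unset Strict Implicit.
Unset Printing Implicit Defensive.

Import Order.TTheory GRing.Theory Num.Theory.

Local Open Scope ring_scope.

(* A multigraph on W is the list of its edges, each one a set of two vertices;
   parallel edges are repetitions in the list, so [size] is the number of edges
   counted with multiplicity. *)
Definition multigraph (W : finType) (E : seq {set W}) : bool :=
  all (fun f : {set W} => #|f| == 2%N) E.

Definition simple_graph (V : finType) (E : {set {set V}}) : bool :=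
  multigraph (enum E).

Definition sqdist (R : realType) (d : nat) (x y : 'rV[R]_d) : R :=
  \sum_(i < d) (x 0 i - y 0 i) ^+ 2.

(* The coordinates of p are algebraically independent over the rationals. *)
Definition generic (R : realType) (d : nat) (W : finType)
    (p : W -> 'rV[R]_d) : Prop :=
  let coord (k : 'I_#|{: W * 'I_d}|) : R :=
    p (enum_val k).1 0 (enum_val k).2 in
  forall P : {mpoly rat[#|{: W * 'I_d}|]},
    mmap ratr coord P = 0 -> P = 0.

Definition same_bar_lengths (R : realType) (d : nat) (W : finType)
    (E : seq {set W}) (p q : W -> 'rV[R]_d) : Prop :=
  forall u w, [set u; w] \in E -> sqdist (q u) (q w) = sqdist (p u) (p w).

Definition congruent (R : realType) (d : nat) (W : finType)
    (p q : W -> 'rV[R]_d) : Prop :=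
  forall u w, sqdist (q u) (q w) = sqdist (p u) (p w).

(* Rigidity of a bar-and-joint framework in the sense of Asimow and Roth: every
   sufficiently close placement with the same bar lengths is congruent to p. *)
Definition rigid_framework (R : realType) (d : nat) (W : finType)
    (E : seq {set W}) (p : W -> 'rV[R]_d) : Prop :=
  exists2 eps : R, 0 < eps &
    forall q : W -> 'rV[R]_d,
      (forall w i, `|q w 0 i - p w 0 i| < eps) ->
      same_bar_lengths E p q -> congruent p q.

(* Either all generic placements of a graph are rigid or none is, and generic
   placements exist, so it does not matter which one is chosen. *)
Definition d_rigid (R : realType) (d : nat) (W : finType)
    (E : seq {set W}) : Prop :=
  exists2 p : W -> 'rV[R]_d, generic p & rigid_framework E p.

Definition minimally_rigid (R : realType) (d : nat) (W : finType)
    (E : seq {set W}) : Prop :=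
  [/\ multigraph E, d_rigid R d E &
      forall E' : seq {set W}, multigraph E' -> d_rigid R d E' ->
        (size E <= size E')%N].

Definition spanning_subgraph (V : finType) (S : {set {set V}}) : seq {set V} :=
  enum S.

(* Vertices left after identifying the endpoints of e; [None] is the merged one. *)
Definition merged_vertices (V : finType) (e : {set V}) : finType :=
  option {x : V | x \notin e}.

Definition merge_endpoints (V : finType) (e : {set V}) (x : V) : merged_vertices e :=
  insub x.

(* Both cases of G(V,S)/e at once: the edge e is removed from S if it is there,
   and every other edge of S is kept, with multiplicity. *)
Definition contract (V : finType) (S : {set {set V}}) (e : {set V}) :
    seq {set merged_vertices e} :=
  [seq merge_endpoints e @: f | f : {set V} <- enum (S :\ e)].

(* Main.v *)
(* A generic framework is rigid if and only if its edges span the row space of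
   the rigidity matrix of the complete graph.  Edge lengths are quadratic, so
   their secants are their gradients at midpoints: placements p and q that give
   the same lengths to a basis of the rows at (p + q) / 2 give the same lengths
   to all edges in the span.  A row outside the span is moved, with a basis of
   the other rows fixed, by solving a quadratic system with a contraction.

   Let D = E \ e.  With r_m the generic 2-dimensional rank after merging the
   ends of e, and r_2(B) the generic 2-dimensional rank of B + e, the required
   sets are complements in D of bases of r_m, r_m and r_2, so by Rado's theorem
   a partition of D exists as soon as 2|B| < 2 r_m(B) + r_2(B) for B in D.
   To prove this, shear a generic placement in space so that e is parallel to
   the x-axis, and delete the columns of the ends of e.  The rows of B stay
   independent (equilibrium of forces and moments), so with r(xyz) = |B|, the
   ranks of the column blocks satisfy
     |B| - r(yz) <= r(xy) - r(y)   and   |B| - r(yz) <= r(x) <= r(y),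
   the last one because the rows in x and y are proportional; moreover
   r(yz) <= r_m(B) and r(xy) + 1 <= r_2(B). *)
Require Import Defs.
From HB Require Import structures.
From mathcomp Require Import all_boot all_order all_algebra.
From mathcomp Require Import reals.
From mathcomp Require Import zify ring lra.
From mathcomp Require interval_inference classical_sets functions topology.
From mathcomp Require normedtype sequences.
From mathcomp.multinomials Require mpoly.

Set Implicit Arguments.
Unset Strict Implicit.
Unset Printing Implicit Defensive.

Import Order.TTheory GRing.Theory Num.Theory.

(** * Rado's theorem for submodular functions *)

(** Induction on the total size of the sets [X i]. When all are singletons the choice is forced and
    the hypothesis becomes the conclusion; otherwise one set loses an element. Subtracting [g set0]
    normalizes [g], and the conclusion says that the transversal is independent. *)
Lemma submodular_transversal (I T : finType) (t0 : T) (g : {set T} -> nat)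
    (D : {set I}) (X : I -> {set T}) :
  (forall A B : {set T}, A \subset B -> g A <= g B) ->
  (forall A B, g (A :|: B) + g (A :&: B) <= g A + g B) ->
  (forall A : {set I}, A \subset D -> #|A| + g set0 <= g (\bigcup_(i in A) X i)) ->
  exists s : I -> T, {in D, forall i, s i \in X i} /\
    forall A : {set I}, A \subset D -> #|A| + g set0 <= g (s @: A).
Proof.
move=> gS gsub; have [n] := ubnP (\sum_(i in D) #|X i|).
elim: n X => // n IHn X; rewrite ltnS => leXn hall.
pose del i t j := if j == i then X i :\ t else X j.
case: (pickP [pred i | (i \in D) && (1 < #|X i|)]) => [i|X_le1]; last first.
  have pickX i : i \in D -> exists t, X i = [set t].
    move=> iD; apply/cards1P; rewrite eqn_leq.
    move: (X_le1 i); rewrite /= iD /= ltnNge => /negbFE -> /=.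
    rewrite lt0n cards_eq0; apply/eqP => Xi0.
    have := hall [set i]; rewrite sub1set iD big_set1 Xi0 cards1 => /(_ isT).
    by rewrite add1n ltnn.
  pose s i := odflt t0 [pick t in X i].
  have sX i : i \in D -> X i = [set s i].
    move=> iD; have [t Xi] := pickX _ iD; rewrite /s.
    by case: pickP => [u|/(_ t)]; rewrite Xi inE ?eqxx // => /eqP ->.
  exists s; split=> [i iD|A sAD]; first by rewrite sX ?set11.
  suff -> : s @: A = \bigcup_(i in A) X i by apply: hall.
  apply/setP => t; apply/imsetP/bigcupP => [[i iA ->]|[i iA]].
    by exists i; rewrite // sX ?set11 // (subsetP sAD).
  by rewrite sX ?(subsetP sAD) // inE => /eqP ->; exists i.
(* Deleting a or deleting b from X i preserves the hypothesis: two sets that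
   violate it contradict submodularity. *)
case/andP=> /= iD /card_gt1P[a] [b] [aX bX nab].
have step t : t \in X i -> [forall A : {set I}, (A \subset D) ==>
    (#|A| + g set0 <= g (\bigcup_(j in A) del i t j))] ->
    exists s : I -> T, {in D, forall i, s i \in X i} /\
      forall A : {set I}, A \subset D -> #|A| + g set0 <= g (s @: A).
  move=> tX /forallP ht; have [||s [sX hs]] := IHn (del i t).
  - apply: leq_trans leXn; rewrite (bigD1 i) //= [ltnRHS](bigD1 i) //=.
    rewrite /del eqxx (cardsD1 t (X i)) tX -addSn leq_add // leq_sum // => j.
    by case/andP=> _ /negPf ->.
  - by move=> A sAD; apply: (implyP (ht A)).
  exists s; split=> // j jD; have := sX j jD; rewrite /del.
  by case: eqP => [->|//]; case/setD1P.
have [/(step _ aX)//|/forallPn[A]] := boolP [forall A : {set I}, (A \subset D) ==>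
    (#|A| + g set0 <= g (\bigcup_(j in A) del i a j))].
rewrite negb_imply -ltnNge => /andP[sAD hA].
have [/(step _ bX)//|/forallPn[B]] := boolP [forall A : {set I}, (A \subset D) ==>
    (#|A| + g set0 <= g (\bigcup_(j in A) del i b j))].
rewrite negb_imply -ltnNge => /andP[sBD hB].
have memi t (C : {set I}) : C \subset D ->
    g (\bigcup_(j in C) del i t j) < #|C| + g set0 -> i \in C.
  move=> sCD; apply: contraTT => niC; rewrite -leqNgt.
  suff -> : \bigcup_(j in C) del i t j = \bigcup_(j in C) X j by apply: hall.
  apply: eq_bigr => j jC; rewrite /del ifN //.
  by apply: contraNneq niC => <-.
have iA := memi _ _ sAD hA; have iB := memi _ _ sBD hB.
set P := \bigcup_(j in A) _ in hA; set Q := \bigcup_(j in B) _ in hB.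
(* As a and b differ, each element of [X i] survives in [P] or in [Q], so the union covers
   everything. The intersection loses only the index i, which costs 1, while [hA] and [hB] together
   are short by 2. *)
have hU : #|A :|: B| + g set0 <= g (P :|: Q).
  apply: leq_trans (hall _ _) (gS _ _ _); first by rewrite subUset sAD.
  apply/bigcupsP => j jAB; apply/subsetP => t tX.
  have [ji|nji] := eqVneq j i.
    rewrite ji in tX; have [tb|ntb] := eqVneq t b; apply/setUP.
      left; apply/bigcupP; exists i => //.
      by rewrite /del eqxx !inE tb eq_sym nab -tb.
    right; apply/bigcupP; exists i => //.
    by rewrite /del eqxx !inE ntb.
  case/setUP: jAB => jC; apply/setUP; [left|right];
    by apply/bigcupP; exists j => //; rewrite /del (negPf nji).
have hI : #|(A :&: B) :\ i| + g set0 <= g (P :&: Q).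
  apply: leq_trans (hall _ _) (gS _ _ _).
    by apply: subset_trans (subD1set _ _) (subset_trans (subsetIl _ _) sAD).
  apply/bigcupsP => j /setD1P[/negPf nji /setIP[jA jB]]; rewrite subsetI.
  apply/andP; split; [apply: (bigcup_max j)|apply: (bigcup_max j)] => //;
    by rewrite /del nji.
have := gsub P Q; have := cardsUI A B.
have := cardsD1 i (A :&: B); rewrite inE iA iB /=; lia.
Qed.

(** A set is independent in the dual of [r k] on D exactly when its complement in D keeps full rank.
    So each f in D chooses a copy (f, k), and the chosen copies must be independent in the direct
    sum of the duals. *)
Lemma spanning_partition (T : finType) (n : nat) (k0 : 'I_n) (D : {set T})
    (r : 'I_n -> {set T} -> nat) :
  (forall k A B, r k (A :|: B) + r k (A :&: B) <= r k A + r k B) ->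
  (forall k A B, r k (A :|: B) <= r k A + #|B|) ->
  (forall A : {set T}, A \subset D ->
     #|A| + \sum_k r k D <= \sum_k (#|A| + r k (D :\: A))) ->
  exists s : T -> 'I_n, forall k, r k D <= r k (D :\: [set f in D | s f == k]).
Proof.
move=> rsub runit hall.
have [D0|[t0 t0D]] := set_0Vmem D.
  by exists (fun=> k0) => k; rewrite D0 set0D.
(* Apart from a constant, |X| + r (D \ X) is the rank function of the dual. *)
pose proj k (X : {set T * 'I_n}) := [set f | (f, k) \in X].
pose g X := \sum_k (#|proj k X| + r k (D :\: proj k X)).
have proj0 k : proj k set0 = set0 by apply/setP => f; rewrite !inE.
have g0 : g set0 = \sum_k r k D.
  by apply: eq_bigr => k _; rewrite proj0 cards0 setD0.
pose fiber (f : T) : {set T * 'I_n} := [set t | t.1 == f].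
have [|||s [sD hs]] := @submodular_transversal _ _ (t0, k0) g D fiber.
- move=> A B sAB; apply: leq_sum => k _.
  have sP : proj k A \subset proj k B.
    by apply/subsetP => f; rewrite !inE; apply: (subsetP sAB).
  have -> : D :\: proj k A = (D :\: proj k B) :|: (D :&: (proj k B :\: proj k A)).
    apply/setP => f; move/subsetP/(_ f): sP; rewrite !inE.
    by case: (_ \in A); case: (_ \in B); case: (_ \in D) => // /(_ isT).
  have := runit k (D :\: proj k B) (D :&: (proj k B :\: proj k A)).
  have := subset_leq_card (subsetIr D (proj k B :\: proj k A)).
  have := cardsID (proj k A) (proj k B); rewrite (setIidPr sP); lia.
- move=> A B; rewrite -!big_split; apply: leq_sum => k _ /=.
  have -> : proj k (A :|: B) = proj k A :|: proj k B by apply/setP => f; rewrite !inE.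
  have -> : proj k (A :&: B) = proj k A :&: proj k B by apply/setP => f; rewrite !inE.
  rewrite setDUr setDIr; have := rsub k (D :\: proj k A) (D :\: proj k B).
  have := cardsUI (proj k A) (proj k B); lia.
- move=> A sAD; rewrite g0; apply: leq_trans (hall A sAD) _.
  apply: leq_sum => k _.
  have -> // : proj k (\bigcup_(i in A) fiber i) = A.
  apply/setP => f; rewrite inE; apply/bigcupP/idP => [[i iA]|fA].
    by rewrite inE /= => /eqP ->.
  by exists f; rewrite ?inE.
have s1 f : f \in D -> (s f).1 = f by move=> /sD; rewrite inE => /eqP.
exists (fun f => (s f).2) => k; set A := [set f in D | _].
have sAD : A \subset D by apply/subsetP => f; rewrite inE => /andP[].
(* The transversal is tested on the class of k alone: its image lies in copy k, so the terms of the
   other copies are the constants [r j D] and cancel. *)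
have projE j : proj j (s @: A) = if j == k then A else set0.
  apply/setP => f; rewrite inE; apply/imsetP/idP => [[f' f'A sf']|].
    move: (f'A); rewrite inE => /andP[f'D /eqP sk].
    have ff' : f' = f by rewrite -(s1 f' f'D) -sf'.
    have jk : j = k by rewrite -sk -sf'.
    by rewrite jk eqxx -ff'.
  have [->|_] := eqVneq j k; last by rewrite inE.
  move=> fA; exists f => //; move: fA; rewrite inE => /andP[fD /eqP <-].
  by rewrite -[LHS](congr1 (fun z => (z, (s f).2)) (s1 f fD)) -surjective_pairing.
have rest : \sum_(j | j != k) (#|proj j (s @: A)| + r j (D :\: proj j (s @: A))) =
    \sum_(j | j != k) r j D.
  by apply: eq_bigr => j /negPf njk; rewrite projE njk cards0 setD0.
have := hs A sAD; rewrite g0 /g (bigD1 k) //= [leqRHS](bigD1 k) //= rest.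
by rewrite projE eqxx addnA leq_add2r leq_add2l.
Qed.

(* Here n is |V|, m is |D|, rD and qD are r_m(D) and r_2(D); a and b are the
   sizes of a part of D and of its complement, whose ranks are rb, r0 or r1
   for r_m and qb or q2 for r_2. *)
Lemma count_hall n m a b rD qD rb qb :
  3 < n -> 3 * n <= m + 7 -> a + b = m -> rD + 3 <= 2 * (n - 1) ->
  qD + 3 <= 2 * n -> 2 * b < 2 * rb + qb ->
  a + (rD + rD + qD) <= a + rb + (a + rb) + (a + qb).
(* The upper bounds give 2 rD + qD <= 6n - 13 <= 2m + 1 = 2a + (2b + 1). *)
Proof. lia. Qed.

Lemma count_sizes n m a0 a1 a2 b0 b1 b2 rD r0 r1 qD q2 :
  3 < n -> 3 * n <= m + 7 -> rD + 3 <= 2 * (n - 1) -> qD + 3 <= 2 * n ->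
  2 * m < 2 * rD + qD -> a0 + a1 + a2 = m ->
  a0 + b0 = m -> a1 + b1 = m -> a2 + b2 = m ->
  rD <= r0 -> rD <= r1 -> qD <= q2 -> r0 <= b0 -> r1 <= b1 -> q2 <= b2 + 1 ->
  [/\ a0 = n - 2, a1 = n - 2 & a2 = n - 3] /\
  [/\ 2 * n <= r0 + 5, 2 * n <= r1 + 5 & 2 * n <= q2 + 3].
Proof.
move=> n3 mn rn qn rqm am ab0 ab1 ab2 rr0 rr1 qq2 rb0 rb1 qb2.
(* From 2m < 2 rD + qD <= 6n - 13 and m >= 3n - 7, all these bounds are equalities. *)
have [rE qE mE] : [/\ rD + 5 = 2 * n, qD + 3 = 2 * n & m + 7 = 3 * n].
  by move: n3 mn rn qn rqm; clear; split; lia.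
split; last first.
  by split; [rewrite -rE leq_add2r|rewrite -rE leq_add2r|rewrite -qE leq_add2r].
(* The lower bounds 2n - 5, 2n - 5 and 2n - 4 on the complements add up to 6n - 14 = 2m, which is b0
   + b1 + b2; hence each is attained. *)
have b0n : 2 * n <= b0 + 5 by rewrite -rE leq_add2r (leq_trans rr0).
have b1n : 2 * n <= b1 + 5 by rewrite -rE leq_add2r (leq_trans rr1).
have b2n : 2 * n <= b2 + 4.
  by move: qE qq2 qb2; clear; lia.
by move: n3 mE am ab0 ab1 ab2 b0n b1n b2n; clear; split; lia.
Qed.

Local Open Scope ring_scope.

(** * Rank of a finite family of vectors *)

(** Square generators [<<v f>>] stand for the row vectors, so that the spans can be added up in one
    matrix type. *)
Definition rspan (F : fieldType) (T : finType) (N : nat) (v : T -> 'rV[F]_N)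
  (B : {set T}) : 'M[F]_N := (\sum_(f in B) <<v f>>)%MS.

Definition rk (F : fieldType) (T : finType) (N : nat) (v : T -> 'rV[F]_N)
  (B : {set T}) : nat := \rank (rspan v B).

Definition indep (F : fieldType) (T : finType) (N : nat) (v : T -> 'rV[F]_N)
    (B : {set T}) : Prop :=
  forall c : T -> F, \sum_(f in B) c f *: v f = 0 -> {in B, forall f, c f = 0}.

Section OneFamily.

Variables (F : fieldType) (T : finType) (N : nat) (v : T -> 'rV[F]_N).
Implicit Types A B : {set T}.

Lemma rspanP B (w : 'rV_N) :
  reflect (exists c : T -> F, w = \sum_(f in B) c f *: v f)
    (w <= rspan v B)%MS.
Proof.
apply: (iffP sub_sumsmxP) => [[u ->]|[c ->]].
  have h f : exists a, u f *m <<v f>>%MS == a *: v f.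
    have /sub_rVP[a ->] : (u f *m <<v f>> <= v f)%MS.
      by rewrite (submx_trans (submxMl _ _)) // genmxE.
    by exists a.
  exists (fun f => xchoose (h f)); apply: eq_bigr => f _.
  exact/eqP/(xchooseP (h f)).
have h f : exists u : 'rV_N, c f *: v f == u *m <<v f>>%MS.
  have /submxP[u ->] : (c f *: v f <= <<v f>>)%MS.
    by rewrite scalemx_sub // genmxE.
  by exists u.
exists (fun f => xchoose (h f)); apply: eq_bigr => f _.
exact/eqP/(xchooseP (h f)).
Qed.

Lemma mem_rspan B f : f \in B -> (v f <= rspan v B)%MS.
Proof.
by move=> fB; rewrite /rspan (bigD1 f) //= (submx_trans _ (addsmxSl _ _)) ?genmxE.
Qed.

Lemma rspan_sub B m (M : 'M_(m, N)) :
  {in B, forall f, (v f <= M)%MS} -> (rspan v B <= M)%MS.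
Proof. by move=> h; apply/sumsmx_subP => f fB; rewrite genmxE h. Qed.

Lemma rspanS A B : A \subset B -> (rspan v A <= rspan v B)%MS.
Proof.
by move=> /subsetP sAB; apply: rspan_sub => f /sAB; apply: mem_rspan.
Qed.

Lemma rkS A B : A \subset B -> (rk v A <= rk v B)%N.
Proof. by move=> sAB; apply/mxrankS/rspanS. Qed.

Lemma rspanU A B : (rspan v (A :|: B) :=: rspan v A + rspan v B)%MS.
Proof.
apply/eqmxP/andP; split.
  apply: rspan_sub => f /setUP[fA|fB].
    exact: submx_trans (mem_rspan fA) (addsmxSl _ _).
  exact: submx_trans (mem_rspan fB) (addsmxSr _ _).
by rewrite addsmx_sub !rspanS ?subsetUl ?subsetUr.
Qed.

Lemma rk_submod A B : (rk v (A :|: B) + rk v (A :&: B) <= rk v A + rk v B)%N.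
Proof.
rewrite /rk -(mxrank_sum_cap (rspan v A) (rspan v B)) rspanU leq_add2l.
by rewrite mxrankS // sub_capmx !rspanS ?subsetIl ?subsetIr.
Qed.

Lemma rk_le_card B : (rk v B <= #|B|)%N.
Proof.
rewrite /rk /rspan (leq_trans (mxrank_sum_leqif _)) //= -sum1_card.
by apply: leq_sum => f _; rewrite genmxE rank_leq_row.
Qed.

Lemma rk0 : rk v set0 = 0%N.
Proof. by apply/eqP; rewrite -leqn0 -(cards0 T) rk_le_card. Qed.

Lemma rkU_le A B : (rk v (A :|: B) <= rk v A + #|B|)%N.
Proof.
have := rk_submod A B; have := rk_le_card B; lia.
Qed.

Lemma rspan_mx B : (rspan v B :=: \matrix_(i < #|B|) v (enum_val i))%MS.
Proof.
apply/eqmxP/andP; split.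
  apply: rspan_sub => f fB; rewrite -(enum_rankK_in fB fB).
  by rewrite -[v _](rowK (fun i : 'I_#|B| => v (enum_val i))) row_sub.
by apply/row_subP => i; rewrite rowK mem_rspan // enum_valP.
Qed.

Lemma indep_rk B : indep v B -> rk v B = #|B|.
Proof.
move=> iB; rewrite /rk rspan_mx; apply/eqP/inj_row_free => u.
have [B0|[f0 f0B]] := set_0Vmem B.
  move=> _; apply/rowP => i; suff : (i < 0)%N by [].
  by rewrite -(cards0 T) -B0 ltn_ord.
rewrite mulmx_sum_row => u0.
have /iB c0 : \sum_(f in B) u 0 (enum_rank_in f0B f) *: v f = 0.
  rewrite -[RHS]u0 big_enum_val /=; apply: eq_bigr => i _.
  by rewrite rowK enum_valK_in.
apply/rowP => i; rewrite mxE.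
by rewrite -(enum_valK_in f0B i) c0 // enum_valP.
Qed.

Lemma rk_indep B : rk v B = #|B| -> indep v B.
Proof.
move=> rB c c0 f fB; apply/eqP; apply: contraTT (leqnn #|B|) => cf.
rewrite -ltnNge -{1}rB (cardsD1 f) fB add1n ltnS.
apply: leq_trans (rk_le_card _); apply: mxrankS.
apply: rspan_sub => g; have [->|ngf] := eqVneq g f; last first.
  by move=> gB; apply: mem_rspan; rewrite !inE ngf.
move=> _; move/eqP: c0; rewrite (bigD1 f) //= addr_eq0 => /eqP cvf.
rewrite -[v f]scale1r -(mulVf cf) -scalerA cvf scalemx_sub // eqmx_opp.
apply: summx_sub => g' /andP[g'B ng'f].
by rewrite scalemx_sub // mem_rspan // !inE ng'f.
Qed.

Lemma indep_setU1 B f :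
  indep v B -> ~~ (v f <= rspan v B)%MS -> indep v (f |: B).
Proof.
move=> /indep_rk rB nf.
have fB : f \notin B by apply: contra nf; apply: mem_rspan.
apply: rk_indep; apply/eqP; rewrite eqn_leq rk_le_card cardsU1 fB add1n -rB.
apply: rank_ltmx; rewrite ltmxE rspanS ?subsetUr //=.
by apply: contra nf; apply: submx_trans; rewrite mem_rspan // setU11.
Qed.

Lemma exists_basis B :
  exists B0, [/\ B0 \subset B, indep v B0 & (rspan v B <= rspan v B0)%MS].
Proof.
pose P := [pred A : {set T} | (A \subset B) && (rk v A == #|A|)].
have P0 : P set0 by rewrite /= sub0set rk0 cards0 eqxx.
case: (arg_maxnP (fun A : {set T} => #|A|) P0) => B0 /andP[sB0B /eqP rB0] maxB0.
exists B0; split => //; first exact: rk_indep.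
apply: rspan_sub => f fB; apply: contraTT (leqnn #|B0|) => nf.
have fB0 : f \notin B0 by apply: contra nf; apply: mem_rspan.
rewrite -ltnNge; have := maxB0 (f |: B0); rewrite cardsU1 fB0 /= => -> //.
rewrite subUset sub1set fB sB0B /=; apply/eqP/indep_rk.
by apply: indep_setU1 nf; apply: rk_indep.
Qed.

Lemma indep_leq A B : A \subset B -> indep v A -> (#|A| <= rk v B)%N.
Proof. by move=> sAB /indep_rk <-; apply: rkS. Qed.

Lemma indepS A B : A \subset B -> indep v B -> indep v A.
Proof.
move=> sAB /indep_rk rB; apply: rk_indep; apply/eqP.
rewrite eqn_leq rk_le_card /=.
have := rkU_le A (B :\: A); have := cardsID A B.
have -> : A :|: B :\: A = B by rewrite -{1}(setIidPr sAB) setID.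
rewrite (setIidPr sAB) rB; lia.
Qed.

End OneFamily.

Section TwoFamilies.

Variables (F : fieldType) (T : finType).

Lemma sum_dep_restrict (N : nat) (v : T -> 'rV[F]_N) (A B : {set T})
    (c : T -> F) : A \subset B ->
  \sum_(f in B) (if f \in A then c f else 0) *: v f = \sum_(f in A) c f *: v f.
Proof.
move=> /subsetP sAB; rewrite [RHS]big_mkcond [LHS]big_mkcond /=.
apply: eq_bigr => f _; case: ifPn => [|nfB]; first by case: ifP; rewrite // scale0r.
by rewrite ifN //; apply: contra nfB; apply: sAB.
Qed.

(** A subset of B that is independent for [v] remains independent for [v']. *)
Lemma rk_le_dep (N M : nat) (v : T -> 'rV[F]_N) (v' : T -> 'rV[F]_M)
    (B : {set T}) :
  (forall c : T -> F, \sum_(f in B) c f *: v' f = 0 ->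
     \sum_(f in B) c f *: v f = 0) -> (rk v B <= rk v' B)%N.
Proof.
move=> dep; have [B0 [sB0B iB0 spB]] := exists_basis v B.
apply: leq_trans (mxrankS spB) _; rewrite -/(rk v B0) (indep_rk iB0).
apply: indep_leq => // c; rewrite -(sum_dep_restrict _ _ sB0B) => /dep.
by rewrite sum_dep_restrict //; apply: iB0.
Qed.

Lemma rspan_imset (T' : finType) (N : nat) (v : T' -> 'rV[F]_N) (h : T -> T')
    (B : {set T}) : (rspan v (h @: B) :=: rspan (fun f => v (h f)) B)%MS.
Proof.
apply/eqmxP/andP; split; apply: rspan_sub.
  by move=> _ /imsetP[f fB ->]; apply: (mem_rspan (fun f => v (h f))).
by move=> f fB; apply: mem_rspan; apply: imset_f.
Qed.

Lemma rk_row_mx (N M : nat) (x : T -> 'rV[F]_N) (y : T -> 'rV[F]_M)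
    (B : {set T}) : (rk (fun f => row_mx (x f) (y f)) B <= rk x B + rk y B)%N.
Proof.
pose mx n (v : T -> 'rV[F]_n) := \matrix_(i < #|B|) v (enum_val i).
have rkE n (v : T -> 'rV[F]_n) : rk v B = \rank (mx n v)^T.
  by rewrite mxrank_tr /rk rspan_mx.
have mxE2 : mx _ (fun f => row_mx (x f) (y f)) = row_mx (mx _ x) (mx _ y).
  by apply/row_matrixP => i; rewrite row_row_mx !rowK.
by rewrite !rkE mxE2 tr_row_mx -addsmxE mxrank_adds_leqif.
Qed.

(** Submodularity in the columns: after transposition, the spaces X + Y and Y + Z have sum X + Y +
    Z, and their intersection contains Y. *)
Lemma rk_blocks (N M : nat) (x y : T -> 'rV[F]_N) (z : T -> 'rV[F]_M)
    (B : {set T}) :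
  (rk (fun f => row_mx (x f) (row_mx (y f) (z f))) B + rk y B
     <= rk (fun f => row_mx (x f) (y f)) B + rk (fun f => row_mx (y f) (z f)) B)%N.
Proof.
pose mx n (v : T -> 'rV[F]_n) := \matrix_(i < #|B|) v (enum_val i).
have rkE n (v : T -> 'rV[F]_n) : rk v B = \rank (mx n v)^T.
  by rewrite mxrank_tr /rk rspan_mx.
have mxE2 n m (v : T -> 'rV[F]_n) (w : T -> 'rV[F]_m) :
    mx _ (fun f => row_mx (v f) (w f)) = row_mx (mx _ v) (mx _ w).
  by apply/row_matrixP => i; rewrite row_row_mx !rowK.
rewrite !rkE !mxE2 !tr_row_mx.
set X := (mx _ x)^T; set Y := (mx _ y)^T; set Z := (mx _ z)^T.
have colUl m1 m2 n (A : 'M[F]_(m1, n)) (C : 'M_(m2, n)) : (A <= col_mx A C)%MS.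
  by rewrite -addsmxE addsmxSl.
have colUr m1 m2 n (A : 'M[F]_(m1, n)) (C : 'M_(m2, n)) : (C <= col_mx A C)%MS.
  by rewrite -addsmxE addsmxSr.
rewrite -(mxrank_sum_cap (col_mx X Y) (col_mx Y Z)) leq_add // mxrankS //.
  by rewrite col_mx_sub addsmxSr andbT (submx_trans _ (addsmxSl _ _)).
by rewrite sub_capmx colUr colUl.
Qed.

End TwoFamilies.

(** * Perturbation of quadratic systems *)

Section FixedPoint.

Import interval_inference classical_sets functions topology normedtype sequences.
Import numFieldNormedType.Exports.
Local Open Scope ring_scope.
Local Open Scope classical_set_scope.

Lemma mx_norm_leP (R : realType) (k : nat) (x : 'rV[R]_k) (r : R) : 0 <= r ->
  reflect (forall i, `|x 0 i| <= r) (`|x| <= r).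
Proof.
move=> r0; rewrite [leLHS]/Num.norm /= mx_normrE.
apply: (iffP idP) => [/bigmax_leP[_ h] i|h]; first exact: (h (0, i)).
by apply/bigmax_leP; split => // -[a i] _ /=; rewrite (ord1 a).
Qed.

(** Banach's theorem on the closed ball of radius r for the sup norm, phrased entrywise as it is
    applied to quadratic systems. *)
Lemma contraction_rV_fixed_point (R : realType) (k : nat)
    (g : 'rV[R]_k -> 'rV[R]_k) (r : R) : 0 < r ->
  (forall x : 'rV[R]_k, (forall i, `|x 0 i| <= r) -> forall i, `|g x 0 i| <= r) ->
  (forall (x y : 'rV[R]_k) (s : R), (forall i, `|x 0 i| <= r) ->
     (forall i, `|y 0 i| <= r) ->
     (forall i, `|x 0 i - y 0 i| <= s) -> forall i, `|g x 0 i - g y 0 i| <= s / 2) ->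
  exists2 x : 'rV[R]_k, (forall i, `|x 0 i| <= r) & g x = x.
Proof.
move=> r0 gr glip; have r0' := ltW r0.
pose U : set 'rV[R]_k := closed_ball_ Num.norm 0 r.
have UP x : U x <-> forall i, `|x 0 i| <= r.
  rewrite /U /closed_ball_ /= sub0r normrN; split=> [/(mx_norm_leP _ r0')//|h].
  exact/mx_norm_leP.
have gU : set_fun U U g by move=> x /UP xU; apply/UP; exact: gr.
pose gf : {fun U >-> U} := HB.pack g (isFun.Build _ _ U U g gU).
have half0 : (0 : R) <= 2^-1 by rewrite invr_ge0.
have ctr : is_contraction gf.
  exists (NngNum half0); split => /=; first by rewrite invf_lt1 // ltr1n.
  move=> [x y] [/= /UP xU /UP yU]; apply/mx_norm_leP; first by rewrite mulr_ge0.
  move=> i; rewrite !mxE mulrC; apply: glip => // j.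
  by have := elimT (mx_norm_leP (x - y) (normr_ge0 _)) (lexx _) j; rewrite !mxE.
pose X : completeNormedModType R := HB.pack 'rV[R]_k (Complete.on 'rV[R]_k).
have [||p /UP pU gp] := @banach_fixed_point R X U gf ctr.
- exact: (@closed_closed_ball_ R 'rV[R]_k 0 r).
- by exists 0; apply/UP => i; rewrite mxE normr0.
- by exists p.
Qed.

End FixedPoint.

Lemma mulmx_entry_bound (R : realFieldType) (m n : nat) (x : 'rV[R]_m)
    (A : 'M[R]_(m, n)) (r : R) : (forall i, `|x 0 i| <= r) ->
  forall j, `|(x *m A) 0 j| <= r * \sum_i \sum_j `|A i j|.
Proof.
move=> xr j; rewrite mxE (le_trans (ler_norm_sum _ _ _)) // mulr_sumr.
apply: ler_sum => i _; rewrite normrM.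
have r0 : 0 <= r by apply: le_trans (xr i).
by apply: ler_pM => //; rewrite (bigD1 j) //= lerDl sumr_ge0.
Qed.

Lemma bilinear_bound (R : realFieldType) (m n : nat) (x : 'rV[R]_m)
    (y : 'rV[R]_n) (A : 'M[R]_(m, n)) (r s : R) :
    (forall i, `|x 0 i| <= r) -> (forall j, `|y 0 j| <= s) ->
  `|(x *m A *m y^T) 0 0| <= r * s * \sum_i \sum_j `|A i j|.
Proof.
move=> xr ys; rewrite -mulmxA mxE (le_trans (ler_norm_sum _ _ _)) // mulr_sumr.
apply: ler_sum => i _; rewrite normrM -mulrA.
have r0 : 0 <= r by apply: le_trans (xr i).
apply: ler_pM => //; rewrite mxE (le_trans (ler_norm_sum _ _ _)) // mulr_sumr.
by apply: ler_sum => j _; rewrite normrM mxE mulrC ler_wpM2r.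
Qed.

(** With a right inverse B of A, a vector x killed by A' satisfies x = x (A - A') B. If A' is close
    to A, this makes the largest entry of x smaller than itself unless x = 0. *)
Lemma row_free_near (R : realFieldType) (m n : nat) (A : 'M[R]_(m, n)) :
  row_free A -> exists2 e : R, 0 < e &
    forall A' : 'M_(m, n), (forall i j, `|A' i j - A i j| < e) -> row_free A'.
Proof.
move=> /row_freeP[B AB1].
pose s : R := \sum_k \sum_j `|B k j|.
have s0 : 0 <= s by rewrite sumr_ge0 // => ? _; rewrite sumr_ge0.
(* The summand 1 makes c positive and larger than m s, so that the shrinking factor m s / c is below
   1. *)
pose c : R := m%:R * s + 1.
have c0 : 0 < c by rewrite ltr_wpDl // mulr_ge0 // ler0n.
exists c^-1 => [|A' hA']; first by rewrite invr_gt0.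
apply: inj_row_free => x xA'; apply/rowP => i0; apply/eqP; rewrite [X in _ == X]mxE.
have [j0 _ maxj] := @Order.TotalTheory.arg_maxP _ _ _ i0 xpredT (fun i => `|x 0 i|) isT.
have xE : x = x *m (A - A') *m B.
  by rewrite mulmxBr xA' subr0 -mulmxA AB1 mulmx1.
have xd k : `|(x *m (A - A')) 0 k| <= `|x 0 j0| * (m%:R * c^-1).
  rewrite mxE (le_trans (ler_norm_sum _ _ _)) //.
  have -> : `|x 0 j0| * (m%:R * c^-1) = \sum_(i < m) `|x 0 j0| * c^-1.
    by rewrite sumr_const card_ord mulrCA mulr_natl.
  apply: ler_sum => i _; rewrite normrM ler_pM //; first exact: maxj.
  by rewrite !mxE distrC ltW.
have := mulmx_entry_bound B xd j0; rewrite -xE -/s -mulrA => le1.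
have lt1 : m%:R / c * s < 1.
  by rewrite mulrAC ltr_pdivrMr // mul1r ltrDl.
have xj0 : `|x 0 j0| = 0.
  apply/eqP; rewrite eq_le normr_ge0 andbT leNgt; apply/negP => xpos.
  have := le_lt_trans le1 (_ : _ < `|x 0 j0| * 1).
  by rewrite ltr_pM2l // mulr1 ltxx => /(_ lt1).
by rewrite -normr_le0 -xj0; apply: maxj.
Qed.

(** Half the Jacobian of the system at p has the rows [p *m S i]. Moving p only along a right
    inverse of it turns the linear part into 2y, and the remaining quadratic part is small near y =
    0. *)
Lemma quadratic_solve (R : realType) (N k : nat) (S : 'I_k -> 'M[R]_N)
    (p : 'rV[R]_N) (e : R) :
  (forall i, (S i)^T = S i) -> row_free (\matrix_(i < k) (p *m S i)) -> 0 < e ->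
  exists2 d : R, 0 < d & forall t : 'rV[R]_k, (forall i, `|t 0 i| <= d) ->
    exists2 q : 'rV[R]_N, (forall j, `|q 0 j - p 0 j| < e) &
      forall i, (q *m S i *m q^T) 0 0 = (p *m S i *m p^T) 0 0 + t 0 i.
Proof.
move=> Ssym /row_freeP[B]; set M := \matrix_i _ => MB1 e0.
pose T i := B^T *m S i *m B.
pose b : R := 1 + \sum_i \sum_j `|B^T i j|.
pose c : R := 1 + \sum_l \sum_i \sum_j `|T l i j|.
have entryB n m (A C : 'M[R]_(n, m)) i j : (A - C) i j = A i j - C i j.
  by rewrite !mxE.
have sum0 (n m : nat) (A : 'M[R]_(n, m)) : 0 <= \sum_i \sum_j `|A i j|.
  by rewrite sumr_ge0 // => ? _; rewrite sumr_ge0.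
have b0 : 0 < b by rewrite ltr_wpDr.
have c0 : 0 < c by rewrite ltr_wpDr // sumr_ge0 // => ? _; apply: sum0.
have Tc l : \sum_i \sum_j `|T l i j| <= c.
  rewrite /c [X in 1 + X](bigD1 l) //= addrCA lerDl addr_ge0 //.
  by rewrite sumr_ge0 // => ? _; apply: sum0.
(* The first bound keeps q within e of p. The second makes the quadratic terms at most half of r, so
   that the iteration maps the ball to itself and contracts by 1/2. *)
pose r := Num.min (e / (2 * b)) (1 / (2 * c)).
have r0 : 0 < r by rewrite lt_min !divr_gt0 // mulr_gt0.
have rb : r * b < e.
  have h : r <= e / (2 * b) by rewrite ge_min lexx.
  apply: le_lt_trans (ler_wpM2r (ltW b0) h) _.
  rewrite invfM -!mulrA mulVf ?mulr1 ?gt_eqF //; lra.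
have rc : r * c <= 1 / 2.
  have h : r <= 1 / (2 * c) by rewrite ge_min lexx orbT.
  apply: le_trans (ler_wpM2r (ltW c0) h) _.
  by rewrite invfM -!mulrA mulVf ?mulr1 // gt_eqF.
exists r => // t tr.
(* For q = p + y B^T the system reads 2 y_i + y T_i y^T = t_i. *)
pose g (y : 'rV[R]_k) := \row_i ((t 0 i - (y *m T i *m y^T) 0 0) / 2).
have [||y yr gy] := @contraction_rV_fixed_point R k g r r0.
- move=> y yr i; rewrite mxE.
  have := bilinear_bound (T i) yr yr; have := tr i.
  have : r * r * (\sum_a \sum_b0 `|T i a b0|) <= r / 2.
    rewrite -mulrA ler_wpM2l ?(ltW r0) // -[_^-1]mul1r.
    by apply: le_trans rc; rewrite ler_wpM2l ?(ltW r0).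
  rewrite !ler_norml; move: (_ 0 0) => u; lra.
- move=> y z s yr zr yzs i; rewrite [g y 0 i]mxE [g z 0 i]mxE.
  have -> : (t 0 i - (y *m T i *m y^T) 0 0) / 2 - (t 0 i - (z *m T i *m z^T) 0 0) / 2
      = - (((y - z) *m T i *m y^T) 0 0 + (z *m T i *m (y - z)^T) 0 0) / 2.
    rewrite linearB /= !mulmxBl mulmxBr 2!entryB; ring.
  have yzs' j : `|(y - z) 0 j| <= s by rewrite !mxE.
  have := bilinear_bound (T i) yzs' yr.
  have := bilinear_bound (T i) zr yzs'.
  have s0 : 0 <= s by apply: le_trans (yzs i).
  have : r * s * (\sum_a \sum_b0 `|T i a b0|) <= s / 2.
    rewrite mulrAC mulrC ler_wpM2l // -[_^-1]mul1r.
    by apply: le_trans rc; rewrite ler_wpM2l ?(ltW r0).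
  rewrite [s * r]mulrC !ler_norml; move: (_ 0 0) (_ 0 0) => u v; lra.
have xr : forall j, `|(y *m B^T) 0 j| <= r * b.
  move=> j; apply: le_trans (mulmx_entry_bound _ yr j) _.
  by rewrite ler_wpM2l ?(ltW r0) // /b lerDr.
exists (p + y *m B^T) => [j|i].
  by rewrite mxE addrAC subrr add0r (le_lt_trans (xr j)).
have pSx : (p *m S i *m (y *m B^T)^T) 0 0 = y 0 i.
  rewrite trmx_mul trmxK mulmxA.
  have -> : p *m S i *m B = row i (M *m B) by rewrite row_mul rowK.
  by rewrite MB1 -row_mul mul1mx !mxE.
have tr00 (A : 'M[R]_1) : A^T 0 0 = A 0 0 by rewrite mxE.
have xSp : (y *m B^T *m S i *m p^T) 0 0 = y 0 i.
  by rewrite -pSx -[RHS]tr00 !trmx_mul !trmxK Ssym !mulmxA.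
have xSx : (y *m B^T *m S i *m (y *m B^T)^T) 0 0 = t 0 i - 2 * y 0 i.
  have /rowP/(_ i) := gy; rewrite mxE => /(canRL (mulfVK _)) gyi.
  rewrite trmx_mul trmxK !mulmxA.
  have -> : y *m B^T *m S i *m B *m y^T = y *m T i *m y^T by rewrite /T !mulmxA.
  have := gyi (lt0r_neq0 (ltr0n _ 2)); move: (_ 0 0) => u; lra.
rewrite linearD /= !mulmxDl !mulmxDr mxE [X in X + _]mxE [X in _ + X]mxE.
by rewrite pSx xSp xSx; ring.
Qed.

(** * Rigidity matrices and generic placements *)

(* The Laplacian of the single edge f, acting on each of the d coordinates. *)
Definition edge_form (A : pzRingType) (d : nat) (W : finType) (f : {set W}) :
    'M[A]_#|{: W * 'I_d}| :=
  \matrix_(k, l) (((enum_val k).2 == (enum_val l).2)%:R *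
    ((enum_val l).1 \in f)%:R * (((enum_val k).1 == (enum_val l).1)%:R * #|f|%:R
      - ((enum_val k).1 \in f)%:R)).

Definition flat (R : pzRingType) (d : nat) (W : finType) (p : W -> 'rV[R]_d) :
    'rV[R]_#|{: W * 'I_d}| :=
  \row_k p (enum_val k).1 0 (enum_val k).2.

(** Up to sign, the row of f in the rigidity matrix. As a product with a symmetric form, it is
    visibly linear in p and half the gradient of the squared length of f. *)
Definition rigidity_row (R : pzRingType) (d : nat) (W : finType)
    (p : W -> 'rV[R]_d) (f : {set W}) : 'rV[R]_#|{: W * 'I_d}| :=
  flat p *m edge_form R d f.

(** The entry at x of the row of f, in the direction with coordinate function g. Summing over all of
    f avoids naming the other end, since the term y = x vanishes. *)
Definition edge_entry (R : pzRingType) (W : finType) (g : W -> R) (f : {set W})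
    (x : W) : R :=
  (x \in f)%:R * \sum_(y in f) (g x - g y).

Lemma eq_edge_entry (R : pzRingType) (W : finType) (g h : W -> R) (f : {set W}) :
  g =1 h -> edge_entry g f =1 edge_entry h f.
Proof.
by move=> gh x; congr (_ * _); apply: eq_bigr => y _; rewrite !gh.
Qed.

Lemma edge_entry_out (R : pzRingType) (W : finType) (g : W -> R) (f : {set W})
    (x : W) : x \notin f -> edge_entry g f x = 0.
Proof. by move=> /negPf xf; rewrite /edge_entry xf mul0r. Qed.

Lemma edge_entry_pair (R : comPzRingType) (W : finType) (g : W -> R) (u w x : W) :
  u != w ->
  edge_entry g [set u; w] x = (g u - g w) * ((x == u)%:R - (x == w)%:R).
Proof.
move=> nuw; rewrite /edge_entry big_setU1 ?inE //= big_set1 ?inE.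
have [->|nxu] := eqVneq x u; first by rewrite (negPf nuw) /=; ring.
by have [->|nxw] /= := eqVneq x w; ring.
Qed.

Lemma sum_edge_entry (R : comPzRingType) (W : finType) (g h : W -> R) (u w : W) :
  u != w ->
  \sum_x edge_entry g [set u; w] x * h x = (g u - g w) * (h u - h w).
Proof.
move=> nuw; rewrite (eq_bigr (fun x => (g u - g w) * ((x == u)%:R * h x
   - (x == w)%:R * h x))) => [|x _]; last by rewrite edge_entry_pair //; ring.
rewrite -mulr_sumr sumrB; congr (_ * (_ - _)).
  by rewrite (bigD1 u) //= eqxx big1 ?addr0 ?mul1r // => y /negPf ->; rewrite mul0r.
by rewrite (bigD1 w) //= eqxx big1 ?addr0 ?mul1r // => y /negPf ->; rewrite mul0r.
Qed.

Lemma map_edge_form (A A' : pzRingType) (g : {rmorphism A -> A'}) (d : nat)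
    (W : finType) (f : {set W}) : map_mx g (edge_form A d f) = edge_form A' d f.
Proof.
by apply/matrixP => k l; rewrite !mxE !(rmorphM, rmorphB, rmorph_nat).
Qed.

Lemma sum_enum_pair (R : nmodType) (W : finType) (d : nat) (F : W * 'I_d -> R) :
  \sum_(k < #|{: W * 'I_d}|) F (enum_val k) = \sum_x \sum_i F (x, i).
Proof.
have -> : \sum_(k < #|{: W * 'I_d}|) F (enum_val k) = \sum_(z in {: W * 'I_d}) F z.
  by rewrite [RHS]big_enum_val.
by rewrite pair_bigA; apply: eq_big => [z|[]].
Qed.

Lemma edge_form_sym (A : pzRingType) (d : nat) (W : finType) (f : {set W}) :
  (edge_form A d f)^T = edge_form A d f.
Proof.
apply/matrixP => k l; rewrite !mxE [(enum_val l).2 == _]eq_sym.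
case: ((enum_val k).2 == _); rewrite ?mul0r // !mul1r [(enum_val l).1 == _]eq_sym.
have [->//|_] := eqVneq (enum_val k).1 (enum_val l).1.
by do 2!case: (_ \in f); rewrite ?mul0r ?mul1r ?subr0 ?sub0r.
Qed.

Lemma rigidity_rowE (R : comPzRingType) (d : nat) (W : finType) (p : W -> 'rV[R]_d)
    (f : {set W}) (x : W) (i : 'I_d) :
  rigidity_row p f 0 (enum_rank (x, i)) = edge_entry (fun y => p y 0 i) f x.
Proof.
pose F (z : W * 'I_d) := p z.1 0 z.2 *
  ((z.2 == i)%:R * (x \in f)%:R * ((z.1 == x)%:R * #|f|%:R - (z.1 \in f)%:R)).
transitivity (\sum_(k < #|{: W * 'I_d}|) F (enum_val k)).
  by rewrite mxE; apply: eq_bigr => k _; rewrite !mxE enum_rankK.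
rewrite sum_enum_pair /F /= /edge_entry.
have -> : \sum_(y in f) (p x 0 i - p y 0 i) = p x 0 i * #|f|%:R - \sum_(y in f) p y 0 i.
  by rewrite sumrB sumr_const mulr_natr.
rewrite (eq_bigr (fun y => (x \in f)%:R * (p y 0 i * (y == x)%:R * #|f|%:R
    - p y 0 i * (y \in f)%:R))) => [|y _].
  rewrite -mulr_sumr sumrB; congr (_ * (_ - _)).
    rewrite (bigD1 x) //= eqxx big1 ?addr0 ?mulr1 // => y /negPf ->.
    by rewrite mulr0 mul0r.
  rewrite [RHS]big_mkcond; apply: eq_bigr => y _.
  by case: (y \in f); rewrite ?mulr1 ?mulr0.
rewrite (bigD1 i) //= eqxx big1 ?addr0 => [|j /negPf ->]; last by rewrite !mul0r mulr0.
rewrite /=; ring.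
Qed.

Lemma rigidity_row_dot (R : comPzRingType) (d : nat) (W : finType)
    (p q : W -> 'rV[R]_d) (u w : W) : u != w ->
  (rigidity_row p [set u; w] *m (flat q)^T) 0 0 =
    \sum_(i < d) (p u 0 i - p w 0 i) * (q u 0 i - q w 0 i).
Proof.
move=> nuw; 
pose F (z : W * 'I_d) := edge_entry (fun y => p y 0 z.2) [set u; w] z.1 * q z.1 0 z.2.
transitivity (\sum_(k < #|{: W * 'I_d}|) F (enum_val k)).
  rewrite mxE; apply: eq_bigr => k _; rewrite [X in _ * X]mxE [X in _ * X]mxE.
  by rewrite /F -rigidity_rowE -surjective_pairing enum_valK.
rewrite sum_enum_pair /F exchange_big /=; apply: eq_bigr => i _.
exact: sum_edge_entry (fun y => p y 0 i) _ _ _ nuw.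
Qed.

Lemma sum_rows_eq0 (R : comPzRingType) (d : nat) (W T : finType) (p : W -> 'rV[R]_d)
    (h : T -> {set W}) (B : {set T}) (c : T -> R) :
  \sum_(f in B) c f *: rigidity_row p (h f) = 0 <->
  forall x i, \sum_(f in B) c f * edge_entry (fun y => p y 0 i) (h f) x = 0.
Proof.
have entry x i : \sum_(f in B) c f * edge_entry (fun y => p y 0 i) (h f) x =
    (\sum_(f in B) c f *: rigidity_row p (h f)) 0 (enum_rank (x, i)).
  by rewrite summxE; apply: eq_bigr => f _; rewrite [RHS]mxE rigidity_rowE.
split=> [s0 x i|s0]; first by rewrite entry s0 mxE.
apply/rowP => k; rewrite [RHS]mxE -(enum_valK k).
by case: (enum_val k) => x i; rewrite -entry s0.
Qed.

(** * Polynomial conditions at generic placements *)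

Section Generic.

Import mpoly.

Definition coord (R : realType) (d : nat) (W : finType) (p : W -> 'rV[R]_d)
  (k : 'I_#|{: W * 'I_d}|) : R := p (enum_val k).1 0 (enum_val k).2.

(** A nonzero value at one placement q, however special, shows that P is not the zero polynomial.
    The non-vanishing results below only exhibit such a q. *)
Lemma generic_eval_neq0 (R : realType) (d : nat) (W : finType)
    (p q : W -> 'rV[R]_d) (P : {mpoly rat[#|{: W * 'I_d}|]}) :
  generic p -> mmap ratr (coord q) P != 0 -> mmap ratr (coord p) P != 0.
Proof.
move=> gen; apply: contraNneq => /gen ->.
by rewrite raddf0.
Qed.

Lemma mmap_rename (F : comNzRingType) (S : comNzRingType)
    (g : {rmorphism F -> S}) (n m : nat) (h : 'I_m -> S) (t : 'I_n -> 'I_m)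
    (P : {mpoly F[n]}) :
  mmap g h (mmap (@mpolyC m F) (fun k => 'X_(t k)) P) = mmap g (h \o t) P.
Proof.
rewrite [mmap (@mpolyC m F) _ P]/mmap rmorph_sum /mmap; apply: eq_bigr => u _.
rewrite rmorphM /= mmapC; congr (_ * _); rewrite /mmap1 rmorph_prod.
by apply: eq_bigr => i _; rewrite rmorphXn /= mmapX mmap1U.
Qed.

(** The coordinates of p' are distinct coordinates of p. Renaming the variables along the injection
    [s] loses no polynomial, because the substitution [back] undoes it. *)
Lemma generic_sub (R : realType) (d d' : nat) (W W' : finType)
    (p : W -> 'rV[R]_d) (p' : W' -> 'rV[R]_d') (s : W' * 'I_d' -> W * 'I_d) :
  injective s -> (forall x i, p' x 0 i = p (s (x, i)).1 0 (s (x, i)).2) ->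
  generic p -> generic p'.
Proof.
move=> inj_s p'E gen c P P0; rewrite {}/c in P0.
pose t (k : 'I_#|{: W' * 'I_d'}|) : 'I_#|{: W * 'I_d}| := enum_rank (s (enum_val k)).
have inj_t : injective t by move=> k l /enum_rank_inj/inj_s/enum_val_inj.
have Q0 : mmap (@mpolyC _ _) (fun k => 'X_(t k)) P = 0 :> {mpoly rat[#|{: W * 'I_d}|]}.
  apply: gen; rewrite mmap_rename -[RHS]P0; apply: eq_bigr => u _; congr (_ * _).
  apply: mmap1_eq => k /=; rewrite /t enum_rankK p'E -surjective_pairing //.
pose back (l : 'I_#|{: W * 'I_d}|) : {mpoly rat[#|{: W' * 'I_d'}|]} :=
  if [pick k | t k == l] is Some k then 'X_k else 0.
have := congr1 (mmap (@mpolyC _ _) back) Q0; rewrite mmap_rename raddf0 => <-.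
rewrite [LHS]mpolyE; apply: eq_bigr => u _; rewrite mul_mpolyC -mmap1_id.
congr (_ *: _); apply: mmap1_eq => k /=; rewrite /back.
by case: pickP => [l /eqP/inj_t -> //|/(_ k)]; rewrite eqxx.
Qed.

(** The map [h] allows several indices to share an edge, as happens for parallel edges after a
    contraction. *)
Lemma generic_rk_max (R : realType) (d : nat) (W T : finType) (p q : W -> 'rV[R]_d)
    (h : T -> {set W}) (B : {set T}) : generic p ->
  (rk (fun f => rigidity_row q (h f)) B <= rk (fun f => rigidity_row p (h f)) B)%N.
Proof.
move=> gen; have [B0 [sB0B iB0 spB]] := exists_basis (fun f => rigidity_row q (h f)) B.
apply: leq_trans (mxrankS spB) _; apply: leq_trans (rkS _ sB0B).
(* A minor that is nonzero at q is a nonzero rational polynomial in the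
   coordinates, so it is nonzero at p. *)
pose N := #|{: W * 'I_d}|.
pose M (r : W -> 'rV[R]_d) := \matrix_(i < #|B0|) rigidity_row r (h (enum_val i)).
have rkM r : rk (fun f => rigidity_row r (h f)) B0 = \rank (M r).
  by rewrite /rk rspan_mx.
rewrite -[\rank _]/(rk _ _) !rkM.
have fullMq : row_full (M q)^T.
  by rewrite /row_full mxrank_tr -rkM (indep_rk iB0).
(* [g] selects columns on which the independent rows at q have an invertible minor; [MX] is that
   minor with variables for the coordinates. *)
pose g := fullrankfun fullMq.
pose MX : 'M[{mpoly rat[N]}]_#|B0| := \matrix_(i, j)
  ((\row_k 'X_k) *m edge_form {mpoly rat[N]} d (h (enum_val j))) 0 (g i).
have MXE r : map_mx (mmap ratr (coord r)) MX = rowsub g (M r)^T.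
  apply/matrixP => i j; rewrite [LHS]mxE [MX i j]mxE [RHS]mxE [RHS]mxE [RHS]mxE.
  rewrite /rigidity_row -(map_edge_form (mmap ratr (coord r))).
  have -> : flat r = map_mx (mmap ratr (coord r)) (\row_k 'X_k).
    by apply/rowP => k; rewrite !mxE mmapX mmap1U.
  by rewrite -map_mxM [RHS]mxE.
have detq : mmap ratr (coord q) (\det MX) != 0.
  rewrite -det_map_mx MXE -unitfE -unitmxE -row_full_unit.
  exact: fullrowsub_full.
have := generic_eval_neq0 gen detq.
rewrite -det_map_mx MXE -unitfE -unitmxE -row_full_unit => /eqP rp.
rewrite (leq_trans (rank_leq_row _)) // -[X in (X <= _)%N]rp -[leqRHS]mxrank_tr.
by apply: mxrankS; apply/row_subP => i; rewrite row_rowsub row_sub.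
Qed.

Lemma mmap_coord (R : realType) (d : nat) (W : finType) (p : W -> 'rV[R]_d)
    (x : W) (i : 'I_d) :
  mmap ratr (coord p) 'X_(enum_rank (x, i)) = p x 0 i.
Proof. by rewrite mmapX mmap1U /coord enum_rankK. Qed.

Lemma generic_coord_neq (R : realType) (d : nat) (W : finType)
    (p : W -> 'rV[R]_d) (x y : W) (i : 'I_d) :
  generic p -> x != y -> p x 0 i != p y 0 i.
Proof.
move=> gen nxy; rewrite -subr_eq0 -!mmap_coord -rmorphB.
apply: (@generic_eval_neq0 _ _ _ _ (fun z => const_mx (z == x)%:R)) => //.
by rewrite rmorphB /= !mmap_coord !mxE eqxx [y == x]eq_sym (negPf nxy) subr0 oner_eq0.
Qed.

(** Projected to two coordinates, distinct segments are not parallel. Up to exchange x is not in {u,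
    w}; then the placement with coordinate i the indicator of u, and the others the indicator of x,
    gives the value 1. *)
Lemma generic_cross_neq0 (R : realType) (d : nat) (W : finType)
    (p : W -> 'rV[R]_d) (x y u w : W) (i j : 'I_d) :
  generic p -> i != j -> u != w -> x != y -> [set x; y] != [set u; w] ->
  (p x 0 j - p y 0 j) * (p u 0 i - p w 0 i) -
    (p x 0 i - p y 0 i) * (p u 0 j - p w 0 j) != 0.
Proof.
move=> gen nij nuw; wlog xuw : x y / x \notin [set u; w] => [hx|] nxy nset.
  have [xuw|] := boolP (x \in [set u; w]); last by move=> /hx; apply.
  have yuw : y \notin [set u; w].
    apply: contra nset => yuw; rewrite eqEcard !cards2 nxy nuw andbT.
    by apply/subsetP => z /set2P[] ->.
  rewrite -oppr_eq0; have := hx y x yuw; rewrite eq_sym nxy setUC => /(_ isT nset).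
  by congr (_ != 0); ring.
rewrite -!mmap_coord -!rmorphB -!rmorphM -rmorphB.
pose q z : 'rV[R]_d := \row_k (if k == i then (z == u)%:R else (z == x)%:R).
apply: (@generic_eval_neq0 _ _ _ _ q) => //.
move: xuw; rewrite !inE negb_or => /andP[/negPf nxu /negPf nxw].
rewrite !(rmorphB, rmorphM) /= !mmap_coord !mxE eqxx [j == i]eq_sym (negPf nij).
rewrite !eqxx ![_ == x]eq_sym (negPf nxy) nxu nxw [w == u]eq_sym (negPf nuw).
by rewrite !subr0 mulr1 mulr0 subr0 oner_eq0.
Qed.

End Generic.

(** * Generic rigidity as a rank condition *)

Section GenericRigidity.

Variables (R : realType) (d : nat) (W : finType).
Implicit Types (p q a b : W -> 'rV[R]_d) (f : {set W}) (B C : {set {set W}}).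

Definition pairs : {set {set W}} := [set f : {set W} | #|f| == 2%N].

Definition midpoint p q (x : W) : 'rV[R]_d := 2^-1 *: (p x + q x).

Definition edge_length p f : R := (rigidity_row p f *m (flat p)^T) 0 0.

Lemma edge_length_sqdist p (u w : W) : u != w ->
  edge_length p [set u; w] = sqdist (p u) (p w).
Proof. by move=> nuw; rewrite /edge_length rigidity_row_dot. Qed.

(* The edge lengths are quadratic, so their secants are exactly their
   gradients at the midpoint. *)
Lemma edge_length_midpoint a b f :
  edge_length a f - edge_length b f =
    2 * (rigidity_row (midpoint a b) f *m (flat a - flat b)^T) 0 0.
Proof.
have midE : flat (midpoint a b) = 2^-1 *: (flat a + flat b).
  by apply/rowP => k; rewrite !mxE.
have sym : (flat a *m edge_form R d f *m (flat b)^T) 0 0 =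
    (flat b *m edge_form R d f *m (flat a)^T) 0 0.
  have tr00 (A : 'M[R]_1) : A^T 0 0 = A 0 0 by rewrite mxE.
  by rewrite -tr00 !trmx_mul trmxK edge_form_sym mulmxA.
rewrite /edge_length /rigidity_row midE -!scalemxAl [in RHS]mxE mulVKf ?pnatr_eq0 //.
rewrite linearB /= mulmxDl mulmxBr !mulmxDl.
have entryB (A C : 'M[R]_1) : (A - C) 0 0 = A 0 0 - C 0 0 by rewrite !mxE.
have entryD (A C : 'M[R]_1) : (A + C) 0 0 = A 0 0 + C 0 0 by rewrite !mxE.
by rewrite entryB !entryD sym; ring.
Qed.

(** By the secant identity, the difference of the placements is orthogonal to the midpoint rows of
    B, hence to their span. *)
Lemma edge_length_eq_span a b B f :
  {in B, forall g, edge_length a g = edge_length b g} ->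
  (rigidity_row (midpoint a b) f <= rspan (rigidity_row (midpoint a b)) B)%MS ->
  edge_length a f = edge_length b f.
Proof.
move=> eqB /rspanP[c rowf]; apply/eqP; rewrite -subr_eq0 edge_length_midpoint.
rewrite rowf mulmx_suml summxE big1 ?mulr0 // => g gB.
have := edge_length_midpoint a b g; rewrite eqB // subrr => /esym/eqP.
by rewrite mulf_eq0 pnatr_eq0 /= => /eqP g0; rewrite -scalemxAl mxE g0 mulr0.
Qed.

Lemma edge_length_eq_rk a b B C f : B \subset C ->
  (rk (rigidity_row (midpoint a b)) C <= rk (rigidity_row (midpoint a b)) B)%N ->
  {in B, forall g, edge_length a g = edge_length b g} ->
  f \in C -> edge_length a f = edge_length b f.
Proof.
move=> sBC rkCB eqB fC; apply: (edge_length_eq_span eqB).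
apply: submx_trans (mem_rspan _ fC) _.
by rewrite -(geq_leqif (mxrank_leqif_sup (rspanS _ sBC))).
Qed.

Lemma midpoint_near q p x i :
  `|midpoint q p x 0 i - p x 0 i| <= `|q x 0 i - p x 0 i|.
Proof.
rewrite !mxE.
have -> : 2^-1 * (q x 0 i + p x 0 i) - p x 0 i = (q x 0 i - p x 0 i) / 2 by field.
rewrite normrM [`|2^-1|]ger0_norm ?invr_ge0 // ler_piMr //.
by rewrite invf_le1 // ler1n.
Qed.

Lemma indep_near p B : indep (rigidity_row p) B ->
  exists2 e : R, 0 < e &
    forall q, (forall x i, `|q x 0 i - p x 0 i| < e) -> indep (rigidity_row q) B.
Proof.
move=> /indep_rk; rewrite /rk rspan_mx => /eqP/row_free_near[e e0 he].
pose s f : R := \sum_k \sum_l `|edge_form R d f k l|.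
have s0 f : 0 <= s f by rewrite sumr_ge0 // => ? _; rewrite sumr_ge0.
pose c : R := \sum_(f in B) s f + 1.
have c0 : 0 < c by rewrite ltr_wpDl // sumr_ge0.
exists (e / (2 * c)) => [|q qp]; first by rewrite divr_gt0 ?mulr_gt0.
apply: rk_indep; rewrite /rk rspan_mx; apply/eqP; apply: he => i j.
pose f := enum_val i; have fB : f \in B by apply: enum_valP.
have -> : (\matrix_(i0 < #|B|) rigidity_row q (enum_val i0)) i j -
    (\matrix_(i0 < #|B|) rigidity_row p (enum_val i0)) i j =
    ((flat q - flat p) *m edge_form R d f) 0 j.
  rewrite mulmxBl -/(rigidity_row q f) -/(rigidity_row p f).
  have entryB (u v : 'rV[R]_#|{: W * 'I_d}|) : (u - v) 0 j = u 0 j - v 0 j.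
    by rewrite !mxE.
  by rewrite entryB; congr (_ - _); rewrite mxE.
have hr k : `|(flat q - flat p) 0 k| <= e / (2 * c) by rewrite !mxE ltW.
have := mulmx_entry_bound (edge_form R d f) hr j; move/le_lt_trans; apply.
rewrite -/(s f); apply: (@le_lt_trans _ _ (e / (2 * c) * c)); last first.
  by rewrite invfM -!mulrA mulVf ?gt_eqF //; lra.
apply: ler_wpM2l; first by rewrite ltW // divr_gt0 // mulr_gt0.
by rewrite /c (bigD1 f fB) /= -addrA lerDl addr_ge0 // sumr_ge0.
Qed.

(** A basis B of the rows at p stays independent at the midpoint of p and a close q. The rank of the
    complete graph there is at most its generic value [#|B|], so B spans all rows at the midpoint
    and its lengths determine all others. *)
Lemma rk_rigid p (E : seq {set W}) : generic p -> multigraph E ->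
  rk (rigidity_row p) [set f in E] = rk (rigidity_row p) pairs ->
  rigid_framework E p.
Proof.
move=> gen mE rkE.
have [B [sBE iB spB]] := exists_basis (rigidity_row p) [set f in E].
have [e e0 he] := indep_near iB; exists e => // q qp len_eq u w.
have [->|nuw] := eqVneq u w.
  by rewrite /sqdist !big1 // => i _; rewrite subrr expr0n.
have sEK : [set f in E] \subset pairs.
  by apply/subsetP => f; rewrite !inE => /(allP mE).
rewrite -!edge_length_sqdist //.
apply: (edge_length_eq_rk (subset_trans sBE sEK)); last 2 first.
- move=> f fB; have /[!inE] fE := subsetP sBE f fB.
  have /cards2P[x [y [nxy fxy]]] := allP mE f fE.
  by rewrite fxy !edge_length_sqdist // len_eq // -fxy.
- by rewrite inE cards2 nuw.
have /indep_rk -> : indep (rigidity_row (midpoint q p)) B.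
  by apply: he => x i; apply: le_lt_trans (midpoint_near _ _ _ _) (qp x i).
rewrite (leq_trans (generic_rk_max (midpoint q p) id pairs gen)) // -rkE.
by rewrite -(indep_rk iB) /rk mxrankS.
Qed.

(** If the row of f0 were outside the span, adding f0 to a basis B would keep independence. Then
    some q arbitrarily close to p changes the length of f0 and fixes those of B, hence those of E by
    the midpoint argument: a forbidden flex. *)
Lemma rigid_rk p (E : seq {set W}) : generic p -> multigraph E ->
  rigid_framework E p ->
  rk (rigidity_row p) [set f in E] = rk (rigidity_row p) pairs.
Proof.
move=> gen mE [eps eps0 rigid].
have sEK : [set f in E] \subset pairs.
  by apply/subsetP => f; rewrite !inE => /(allP mE).
apply/eqP; rewrite eqn_leq rkS //=; apply: mxrankS; apply: rspan_sub => f0 f0K.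
apply: contraT => nf0.
have [B [sBE iB spB]] := exists_basis (rigidity_row p) [set f in E].
have [e1 e10 he1] := indep_near iB.
have f0B : f0 \notin B.
  by apply: contra nf0 => f0B; apply: mem_rspan; apply: (subsetP sBE).
pose C := f0 |: B.
have iC : indep (rigidity_row p) C.
  apply: indep_setU1 => //; apply: contra nf0; move/submx_trans; apply.
  exact: rspanS.
have f0C : f0 \in C by apply: setU11.
pose S (i : 'I_#|C|) := edge_form R d (enum_val i).
have freeS : row_free (\matrix_(i < #|C|) (flat p *m S i)).
  by have := indep_rk iC; rewrite /rk rspan_mx => h; apply/eqP.
(* [eps] brings q within reach of rigidity, and [e1] keeps B independent at the midpoint. *)
have e0 : 0 < Num.min eps e1 by rewrite lt_min eps0.
have [del del0 solve] := quadratic_solve (fun i => edge_form_sym _ _ _) freeS e0.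
have [|v vp vlen] := solve (\row_i (if enum_val i == f0 then del else 0)).
  by move=> i; rewrite mxE; case: ifP; rewrite ?normr0 ?ger0_norm // ltW.
pose q x : 'rV[R]_d := \row_i v 0 (enum_rank (x, i)).
have flatq : flat q = v.
  by apply/rowP => k; rewrite !mxE -surjective_pairing enum_valK.
have qlen f : f \in C ->
    edge_length q f = edge_length p f + (if f == f0 then del else 0).
  move=> fC; have := vlen (enum_rank_in f0C f).
  by rewrite /S [X in _ + X]mxE !enum_rankK_in // /edge_length /rigidity_row flatq.
have qp x i : `|q x 0 i - p x 0 i| < Num.min eps e1.
  by have := vp (enum_rank (x, i)); rewrite !mxE enum_rankK.
have lenB : {in B, forall f, edge_length q f = edge_length p f}.
  move=> f fB; rewrite qlen ?setU1r // ifN ?addr0 //.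
  by apply: contraNneq f0B => <-.
have lenE f : f \in [set f in E] -> edge_length q f = edge_length p f.
  apply: (edge_length_eq_rk sBE _ lenB).
  have /indep_rk -> : indep (rigidity_row (midpoint q p)) B.
    apply: he1 => x i; apply: le_lt_trans (midpoint_near _ _ _ _) _.
    by have := qp x i; rewrite lt_min => /andP[].
  rewrite (leq_trans (generic_rk_max (midpoint q p) id _ gen)) //.
  by rewrite -(indep_rk iB) /rk mxrankS.
have /cards2P[x [y [nxy f0E]]] : #|f0| == 2%N by rewrite inE in f0K.
have : congruent p q.
  apply: rigid => [z i|u w uwE].
    by have := qp z i; rewrite lt_min => /andP[].
  have nuw : u != w by move: (allP mE _ uwE); rewrite /= cards2; case: (u != w).
  by rewrite -!edge_length_sqdist // lenE // inE.
move=> /(_ x y); rewrite -!edge_length_sqdist // -f0E qlen // eqxx => /eqP.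
by rewrite -subr_eq0 addrAC subrr add0r gt_eqF.
Qed.

End GenericRigidity.

(** * Ranks of complete graphs *)

Section RankBounds.

Variables (R : realType).

Definition plane (W : Type) (g h : W -> R) (x : W) : 'rV[R]_2 :=
  \row_i (if i == 0 then g x else h x).

Lemma sum_ord2 (A : nmodType) (F : 'I_2 -> A) : \sum_(i < 2) F i = F 0 + F 1.
Proof. by rewrite big_ord_recl big_ord1; congr (F _ + F _); apply: val_inj. Qed.

Lemma sum_ord3 (A : nmodType) (F : 'I_3 -> A) :
  \sum_(i < 3) F i = F 0 + F 1 + F 2.
Proof.
rewrite !big_ord_recl big_ord0 addr0 addrA.
by congr (F _ + F _ + F _); apply: val_inj.
Qed.

(** The rows are orthogonal to two translations and to the infinitesimal rotation (-y, x). These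
    three motions are independent once two points differ in their first coordinate. *)
Lemma rk_plane_le (W : finType) (p : W -> 'rV[R]_2) (u w : W) :
  p u 0 0 != p w 0 0 -> (rk (rigidity_row p) (pairs W) + 3 <= 2 * #|W|)%N.
Proof.
move=> npuw.
pose g (j : 'I_3) : W -> 'rV[R]_2 :=
  if j == 0 then plane (fun=> 1) (fun=> 0) else
  if j == 1 then plane (fun=> 0) (fun=> 1) else
  plane (fun x => - p x 0 1) (fun x => p x 0 0).
pose T := \matrix_(j < 3) flat (g j).
have rT : \rank T^T = 3%N.
  rewrite mxrank_tr; apply/eqP/inj_row_free => c cT0.
  have eq0 x i : c 0 0 * g 0 x 0 i + c 0 1 * g 1 x 0 i + c 0 2 * g 2 x 0 i = 0.
    have /rowP/(_ (enum_rank (x, i))) := cT0.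
    by rewrite [LHS]mxE sum_ord3 !mxE enum_rankK.
  have eqx x : c 0 0 = c 0 2 * p x 0 1.
    by have := eq0 x 0; rewrite /g /= !mxE /= => h; lra.
  have eqy x : c 0 1 = - (c 0 2 * p x 0 0).
    by have := eq0 x 1; rewrite /g /= !mxE /= => h; lra.
  have c2 : c 0 2 = 0.
    apply/eqP; have /eqP : c 0 2 * (p u 0 0 - p w 0 0) = 0.
      by rewrite mulrBr; have := eqy u; have := eqy w; lra.
    by rewrite mulf_eq0 subr_eq0 (negPf npuw) orbF.
  apply/rowP => j; rewrite [RHS]mxE; case: j => -[|[|[|//]]] ltj.
  - by rewrite -[RHS](mul0r (p u 0 1)) -c2 -eqx; congr (c 0 _); apply: val_inj.
  - rewrite -[RHS]oppr0 -(mul0r (p u 0 0)) -c2 -eqy; congr (c 0 _).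
    exact: val_inj.
  - by rewrite -[RHS]c2; congr (c 0 _); apply: val_inj.
have AT0 : rspan (rigidity_row p) (pairs W) *m T^T = 0.
  apply/sub_kermxP; apply: rspan_sub => f; rewrite inE => /cards2P[y [z [nyz ->]]].
  apply/sub_kermxP; apply/rowP => j.
  have -> : (rigidity_row p [set y; z] *m T^T) 0 j =
      (rigidity_row p [set y; z] *m (flat (g j))^T) 0 0.
    by rewrite [LHS]mxE [RHS]mxE; apply: eq_bigr => k _; rewrite !mxE.
  rewrite rigidity_row_dot // sum_ord2 [RHS]mxE /g.
  by case: eqP => _; [|case: eqP => _]; rewrite !mxE /=; ring.
have := mulmx0_rank_max AT0; rewrite rT => /leq_trans; apply.
by rewrite card_prod card_ord mulnC.
Qed.

Definition simplex_vertex (W : eqType) (a b c x : W) : 'rV[R]_3 :=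
  if x == a then 0 else
  \row_i (i == (if x == b then 0 else if x == c then 1 else 2))%:R.

(** The generic rank is maximal, so one special placement suffices for a lower bound. It may be as
    degenerate as [simplex_vertex], where all vertices other than a, b and c coincide. *)
Lemma rk_space_ge (W : finType) (p : W -> 'rV[R]_3) (a b c : W) :
  a != b -> a != c -> b != c -> generic p ->
  (3 * #|W| <= rk (rigidity_row p) (pairs W) + 6)%N.
Proof.
move=> nab nac nbc gen.
pose q := simplex_vertex a b c.
apply: leq_trans (_ : rk (rigidity_row q) (pairs W) + 6 <= _)%N; last first.
  by rewrite leq_add2r (generic_rk_max q id).
pose D (z : W * 'I_3) : 'rV[R]_#|{: W * 'I_3}| := delta_mx 0 (enum_rank z).
pose Z : {set W * 'I_3} :=
  [set z in [:: (a, 0); (a, 1); (a, 2); (b, 1); (b, 2); (c, 2)]].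
have leZ : (#|Z| <= 6)%N by rewrite cardsE card_size.
(* The rows of the complete graph and the six pinned coordinates Z span. *)
pose S := (rspan (rigidity_row q) (pairs W) + rspan D Z)%MS.
have leS : (\rank S <= rk (rigidity_row q) (pairs W) + 6)%N.
  rewrite (leq_trans (mxrank_adds_leqif _ _)) // leq_add2l.
  exact: leq_trans (rk_le_card D Z) leZ.
apply: leq_trans leS; suff DS z : (D z <= S)%MS.
  suff fullS : (1%:M <= S)%MS.
    have := mxrankS fullS; rewrite mxrank1; apply: leq_trans.
    by rewrite card_prod card_ord mulnC.
  by apply/row_subP => k; rewrite row1 -(enum_valK k) DS.
have ZS z' : z' \in Z -> (D z' <= S)%MS.
  by move=> zZ; apply: submx_trans (mem_rspan _ zZ) (addsmxSr _ _).
pose r y y' : 'rV[R]_#|{: W * 'I_3}| :=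
  \sum_i (q y 0 i - q y' 0 i) *: (D (y, i) - D (y', i)).
have rowS y y' : y != y' -> (r y y' <= S)%MS.
  move=> nyz; suff -> : r y y' = rigidity_row q [set y; y'].
    by apply: submx_trans (addsmxSl _ _); apply: mem_rspan; rewrite inE cards2 nyz.
  apply/rowP => k; rewrite -(enum_valK k); case: (enum_val k) => x i.
  rewrite rigidity_rowE edge_entry_pair // summxE (bigD1 i) //= big1 => [|j nji].
    by rewrite !mxE !(inj_eq enum_rank_inj) !eqxx !xpair_eqE !eqxx !andbT addr0.
  rewrite !mxE !(inj_eq enum_rank_inj) !xpair_eqE ![i == j]eq_sym (negPf nji).
  by rewrite !andbF subrr mulr0.
have qa : q a = 0 by rewrite /q /simplex_vertex eqxx.
have qb : q b = \row_i (i == 0)%:R.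
  by rewrite /q /simplex_vertex eq_sym (negPf nab) eqxx.
have qc : q c = \row_i (i == 1)%:R.
  by rewrite /q /simplex_vertex !(eq_sym c) (negPf nac) (negPf nbc) eqxx.
have Sl (y y' : 'rV_#|{: W * 'I_3}|) : (y <= S)%MS -> (y - y' <= S)%MS -> (y' <= S)%MS.
  by move=> yS yyS; rewrite -[y'](subKr y) addmx_sub // eqmx_opp.
have Sr (y y' : 'rV_#|{: W * 'I_3}|) : (y' <= S)%MS -> (y - y' <= S)%MS -> (y <= S)%MS.
  by move=> yS yyS; rewrite -[y](subrK y') addmx_sub.
have simp := (sub0r, subr0, oppr0, scale0r, addr0, add0r, scaleN1r, scale1r, subrr).
have Da i : (D (a, i) <= S)%MS.
  by apply: ZS; rewrite !inE !xpair_eqE eqxx; case: i => -[|[|[|//]]].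
have Db i : (D (b, i) <= S)%MS.
  case: i => -[|[|[|//]]] lti; last 2 first.
  - by apply: ZS; rewrite !inE !xpair_eqE !eqxx !orbT.
  - by apply: ZS; rewrite !inE !xpair_eqE !eqxx !orbT.
  have -> : Ordinal lti = 0 by apply: val_inj.
  apply: (Sl (D (a, 0))) => //; have := rowS _ _ nab.
  by rewrite /r sum_ord3 qa qb !mxE /= !simp eqmx_opp.
have Dc i : (D (c, i) <= S)%MS.
  have Dc1 : (D (c, 1) <= S)%MS.
    apply: (Sl (D (a, 1))) => //; have := rowS _ _ nac.
    by rewrite /r sum_ord3 qa qc !mxE /= !simp eqmx_opp.
  case: i => -[|[|[|//]]] lti.
  - have -> : Ordinal lti = 0 by apply: val_inj.
    have := rowS _ _ nbc; rewrite /r sum_ord3 qb qc !mxE /= !simp => h.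
    apply: (Sl (D (b, 0))) => //; apply: Sr h.
    by rewrite addmx_sub // eqmx_opp.
  - by have -> : Ordinal lti = 1 by apply: val_inj.
  - by apply: ZS; rewrite !inE !xpair_eqE !eqxx !orbT.
case: z => x i.
have [->//|nxa] := eqVneq x a; have [->//|nxb] := eqVneq x b.
have [->//|nxc] := eqVneq x c.
(* The segments from x to a, b and c have independent directions. The first one yields coordinate 2
   of x, and the other two then yield coordinates 0 and 1. *)
have qx : q x = \row_i (i == 2)%:R.
  by rewrite /q /simplex_vertex (negPf nxa) (negPf nxb) (negPf nxc).
have Dx2 : (D (x, 2) <= S)%MS.
  have := rowS _ _ nxa; rewrite /r sum_ord3 qa qx !mxE /= !simp.
  exact: Sr.
case: i => -[|[|[|//]]] lti.
- have -> : Ordinal lti = 0 by apply: val_inj.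
  have nbx : b != x by rewrite eq_sym.
  have := rowS _ _ nbx; rewrite /r sum_ord3 qb qx !mxE /= !simp => h.
  by apply: (Sl (D (b, 0))) => //; apply: Sr h; rewrite addmx_sub // eqmx_opp.
- have -> : Ordinal lti = 1 by apply: val_inj.
  have ncx : c != x by rewrite eq_sym.
  have := rowS _ _ ncx; rewrite /r sum_ord3 qc qx !mxE /= !simp => h.
  by apply: (Sl (D (c, 1))) => //; apply: Sr h; rewrite addmx_sub // eqmx_opp.
- by have -> : Ordinal lti = 2 by apply: val_inj.
Qed.

End RankBounds.

(** * The rank inequality *)

Section KeyInequality.

Lemma sum_row_mx_eq0 (R : pzRingType) (T : finType) (n m : nat)
    (a : T -> 'rV[R]_n) (b : T -> 'rV[R]_m) (B : {set T}) (c : T -> R) :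
  \sum_(f in B) c f *: row_mx (a f) (b f) = 0 <->
  \sum_(f in B) c f *: a f = 0 /\ \sum_(f in B) c f *: b f = 0.
Proof.
have -> : \sum_(f in B) c f *: row_mx (a f) (b f) =
    row_mx (\sum_(f in B) c f *: a f) (\sum_(f in B) c f *: b f).
  elim/big_rec3: _ => [|f s1 s2 s _ ->]; first by rewrite row_mx0.
  by rewrite scale_row_mx add_row_mx.
by split=> [/eqP|[-> ->]]; rewrite ?row_mx0 // row_mx_eq0 => /andP[/eqP-> /eqP->].
Qed.

(** One coordinate block of the rigidity matrix. The columns of the ends of e are zeroed instead of
    removed, which has the same effect on ranks and keeps the size. *)
Definition masked_row (R : pzRingType) (V : finType) (e : {set V}) (g : V -> R)
    (f : {set V}) : 'rV[R]_#|V| :=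
  \row_k (if enum_val k \in e then 0 else edge_entry g f (enum_val k)).

Lemma sum_masked_eq0 (R : pzRingType) (V : finType) (e : {set V}) (g : V -> R)
    (B : {set {set V}}) (c : {set V} -> R) :
  \sum_(f in B) c f *: masked_row e g f = 0 <->
  {in ~: e, forall x, \sum_(f in B) c f * edge_entry g f x = 0}.
Proof.
split=> [s0 x|s0].
  rewrite inE => xe; have /rowP/(_ (enum_rank x)) := s0.
  rewrite mxE summxE => s0x; rewrite -[RHS]s0x.
  by apply: eq_bigr => f _; rewrite !mxE enum_rankK (negPf xe).
apply/rowP => k; rewrite summxE mxE.
have [ke|ke] := boolP (enum_val k \in e).
  by rewrite big1 // => f _; rewrite !mxE ke mulr0.
rewrite -[RHS](s0 (enum_val k)) ?inE //; apply: eq_bigr => f _.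
by rewrite !mxE (negPf ke).
Qed.

Lemma edge_entry_lin (R : comPzRingType) (V : finType) (g h k : V -> R) (s : R)
    (f : {set V}) (x : V) : (forall y, g y = h y + s * k y) ->
  edge_entry g f x = edge_entry h f x + s * edge_entry k f x.
Proof.
move=> gE; rewrite /edge_entry [s * _]mulrCA -mulrDr; congr (_ * _).
rewrite mulr_sumr -big_split /=; apply: eq_bigr => y _.
by rewrite !gE; ring.
Qed.

Variables (R : realType) (V : finType) (u v : V).
Hypothesis nuv : u != v.
Let e : {set V} := [set u; v].

Lemma edge_of_pairs (B : {set {set V}}) (f : {set V}) : B \subset pairs V -> f \in B ->
  exists x y, x != y /\ f = [set x; y].
Proof. by move=> /subsetP sB /sB; rewrite inE => /cards2P. Qed.

(* Equilibrium of forces and of moments: a self-stress resolved everywhere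
   except at u and v is carried by a multiple of the edge uv. *)
Lemma indep_masked (X Y Z : V -> R) (B : {set {set V}}) :
  B \subset pairs V -> e \notin B -> X u != X v -> Y u = Y v -> Z u = Z v ->
  (forall c : {set V} -> R,
     (forall g x, g = X \/ g = Y \/ g = Z ->
        \sum_(f in e |: B) c f * edge_entry g f x = 0) ->
     {in e |: B, forall f, c f = 0}) ->
  indep (fun f => row_mx (masked_row e X f)
     (row_mx (masked_row e Y f) (masked_row e Z f))) B.
Proof.
move=> sB eB nX eqY eqZ iXYZ c.
case/sum_row_mx_eq0=> /sum_masked_eq0 X0 /sum_row_mx_eq0[].
move=> /sum_masked_eq0 Y0 /sum_masked_eq0 Z0.
(* [rho g x] is the resultant at x of the stress c in direction g, and [rho_dot] is the symmetry of
   the weighted Laplacian. Pairing with the constant 1 gives the balance of forces, pairing with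
   another coordinate that of moments. *)
pose rho (g : V -> R) x := \sum_(f in B) c f * edge_entry g f x.
have rho_dot g h : \sum_x rho g x * h x = \sum_x rho h x * g x.
  rewrite /rho; under eq_bigr do rewrite mulr_suml.
  under [RHS]eq_bigr do rewrite mulr_suml.
  rewrite exchange_big [RHS]exchange_big; apply: eq_bigr => f fB /=.
  under eq_bigr do rewrite -mulrA.
  under [RHS]eq_bigr do rewrite -mulrA.
  rewrite -!mulr_sumr; have [x [y [nxy ->]]] := edge_of_pairs sB fB.
  by rewrite !sum_edge_entry //; ring.
have supp g h : {in ~: e, forall x, rho g x = 0} ->
    \sum_x rho g x * h x = rho g u * h u + rho g v * h v.
  move=> g0; rewrite (bigD1 u) //= (bigD1 v) 1?eq_sym //= big1 ?addr0 //.
  by move=> x /andP[nxu nxv]; rewrite g0 ?mul0r // !inE negb_or nxu nxv.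
have rho_const (g : V -> R) : rho (fun=> 1) =1 fun=> 0.
  move=> x; rewrite /rho big1 // => f fB; have [y [z [nyz ->]]] := edge_of_pairs sB fB.
  by rewrite edge_entry_pair // subrr mul0r mulr0.
have force g : {in ~: e, forall x, rho g x = 0} -> rho g v = - rho g u.
  move=> g0; apply/eqP; rewrite -addr_eq0 addrC; apply/eqP.
  have := supp g (fun=> 1) g0; rewrite rho_dot !mulr1 => <-.
  by rewrite big1 // => x _; rewrite (rho_const g) mul0r.
have moment g h : {in ~: e, forall x, rho g x = 0} ->
    {in ~: e, forall x, rho h x = 0} ->
    rho g u * (h u - h v) = rho h u * (g u - g v).
  move=> g0 h0; have := rho_dot g h; rewrite !supp // !force //.
  by move=> E; rewrite !mulrBr -!mulNr.
have rho0 g : g u = g v -> {in ~: e, forall x, rho g x = 0} -> forall x, rho g x = 0.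
  move=> gE g0; have := moment _ _ g0 X0; rewrite gE subrr mulr0 => /eqP.
  rewrite mulf_eq0 subr_eq0 (negPf nX) orbF => /eqP gu x.
  have [xe|xe] := boolP (x \in e); last by apply: g0; rewrite inE.
  by case/set2P: xe => -> //; rewrite force // gu oppr0.
have rhoY := rho0 _ eqY Y0; have rhoZ := rho0 _ eqZ Z0.
(* This stress on e cancels the resultants of X at u and v. It adds nothing for Y and Z, which agree
   at u and v and whose resultants vanish everywhere. *)
pose c' f := if f == e then - rho X u / (X u - X v) else c f.
have sumc' g x : \sum_(f in e |: B) c' f * edge_entry g f x =
    - rho X u / (X u - X v) * edge_entry g e x + rho g x.
  rewrite big_setU1 //= /c' eqxx; congr (_ + _); apply: eq_bigr => f fB.
  by rewrite ifN //; apply: contraNneq eB => <-.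
have /iXYZ c'0 : forall g x, g = X \/ g = Y \/ g = Z ->
    \sum_(f in e |: B) c' f * edge_entry g f x = 0.
  move=> g x gXYZ; rewrite sumc' edge_entry_pair //.
  case: gXYZ => [->|[|]->]; last 2 first.
  - by rewrite eqY subrr mul0r mulr0 add0r rhoY.
  - by rewrite eqZ subrr mul0r mulr0 add0r rhoZ.
  rewrite mulrA divfK ?subr_eq0 //.
  have [->|nxu] := eqVneq x u; first by rewrite (negPf nuv) subr0 mulr1 addNr.
  have [->|nxv] := eqVneq x v; first by rewrite force // sub0r mulrN1 opprK subrr.
  by rewrite subrr mulr0 add0r; apply: X0; rewrite !inE negb_or nxu.
move=> f fB; have := c'0 f (setU1r _ fB); rewrite /c' ifN //.
by apply: contraNneq eB => <-.
Qed.

(** In each direction the row of an edge is the difference of the coordinates of its ends times a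
    vector that depends on the edge only. *)
Lemma rk_masked_proportional (X Y : V -> R) (B : {set {set V}}) :
  (forall x y, x != y -> [set x; y] \in B -> Y x != Y y) -> B \subset pairs V ->
  (rk (masked_row e X) B <= rk (masked_row e Y) B)%N.
Proof.
move=> nY sB; apply: mxrankS; apply: rspan_sub => f fB.
have [x [y [nxy fE]]] := edge_of_pairs sB fB.
have Yxy : Y x - Y y != 0 by rewrite subr_eq0 nY // -fE.
suff -> : masked_row e X f = ((X x - X y) / (Y x - Y y)) *: masked_row e Y f.
  by rewrite scalemx_sub // mem_rspan.
apply/rowP => k; rewrite !mxE; case: ifP; rewrite ?mulr0 // => _.
by rewrite fE !edge_entry_pair // mulrA divfK.
Qed.

(** Restoring the deleted columns allows e to join a basis: in a dependency, the masked columns,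
    where e is zero, kill the coefficients of the basis, and then the column of u kills that of
    e. *)
Lemma rk_masked_delete (p : V -> 'rV[R]_2) (X Y : V -> R) (B : {set {set V}}) :
  generic p -> X u != X v -> e \notin B ->
  (rk (fun f => row_mx (masked_row e X f) (masked_row e Y f)) B
     < rk (rigidity_row p) (e |: B))%N.
Proof.
move=> gen nX eB; pose q := plane X Y.
apply: leq_trans (generic_rk_max q id _ gen).
set w := (fun f => _); have [B0 [sB0 iB0 spB0]] := exists_basis w B.
have eB0 : e \notin B0 by apply: contra eB; apply: (subsetP sB0).
have -> : (rk w B).+1 = #|e |: B0|.
  rewrite cardsU1 eB0 -(indep_rk iB0) add1n; congr _.+1.
  by apply/eqP; rewrite eqn_leq /rk mxrankS // mxrankS // rspanS.
apply: indep_leq; first exact: setUS.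
move=> c /sum_rows_eq0 c0.
have cX x : \sum_(f in e |: B0) c f * edge_entry X f x = 0.
  rewrite -[RHS](c0 x 0); apply: eq_bigr => f _; congr (_ * _).
  by apply: eq_edge_entry => y; rewrite mxE.
have cY x : \sum_(f in e |: B0) c f * edge_entry Y f x = 0.
  rewrite -[RHS](c0 x 1); apply: eq_bigr => f _; congr (_ * _).
  by apply: eq_edge_entry => y; rewrite mxE.
have cB0 : {in B0, forall f, c f = 0}.
  apply: iB0; apply/sum_row_mx_eq0; split; apply/sum_masked_eq0 => x;
    rewrite inE => xe; [rewrite -[RHS](cX x) | rewrite -[RHS](cY x)];
    by rewrite big_setU1 //= edge_entry_out // mulr0 add0r.
move=> f /setU1P[->|/cB0//]; have := cX u.
rewrite big_setU1 //= big1 => [|g /cB0->]; last by rewrite mul0r.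
rewrite addr0 edge_entry_pair // eqxx (negPf nuv) subr0 mulr1 => /eqP.
by rewrite mulf_eq0 subr_eq0 (negPf nX) orbF => /eqP.
Qed.

Lemma merge_eq (x y : V) :
  (merge_endpoints e x == merge_endpoints e y) =
    (x == y) || ((x \in e) && (y \in e)).
Proof.
rewrite /merge_endpoints.
case: insubP => [x' xe x'E|]; case: insubP => [y' ye y'E|].
- by rewrite (negPf xe) /= orbF -x'E -y'E (inj_eq val_inj).
- rewrite negbK => ye; rewrite (negPf xe) orbF; apply/esym/negbTE.
  by apply: contraNneq xe => ->.
- rewrite negbK => xe; rewrite (negPf ye) andbF orbF; apply/esym/negbTE.
  by apply: contraNneq ye => <-.
by rewrite !negbK => -> ->; rewrite eqxx orbT.
Qed.

Lemma merge_pair (x y : V) : x != y -> [set x; y] != e ->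
  merge_endpoints e x != merge_endpoints e y.
Proof.
move=> nxy; apply: contra; rewrite merge_eq (negPf nxy) /= => /andP[xe ye].
rewrite eqEcard !cards2 nxy nuv andbT.
by apply/subsetP => z /set2P[] ->.
Qed.

(** As Y and Z agree at u and v, the plane placement factors through the merged vertices. The masked
    rows are then those of the merged graph without the columns of the merged vertex. *)
Lemma rk_masked_merge (p : merged_vertices e -> 'rV[R]_2) (Y Z : V -> R)
    (B : {set {set V}}) :
  generic p -> Y u = Y v -> Z u = Z v -> B \subset pairs V -> e \notin B ->
  (rk (fun f => row_mx (masked_row e Y f) (masked_row e Z f)) B
     <= rk (fun f : {set V} => rigidity_row p (merge_endpoints e @: f)) B)%N.
Proof.
move=> gen eqY eqZ sB eB.
pose q (x : merged_vertices e) : 'rV[R]_2 :=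
  if x is Some x' then plane Y Z (val x') else plane Y Z u.
apply: leq_trans (generic_rk_max q (fun f : {set V} => merge_endpoints e @: f) B gen).
have qE x : q (merge_endpoints e x) = plane Y Z x.
  rewrite /merge_endpoints; case: insubP => [x' _ <- //|].
  by rewrite negbK => /set2P[] -> //=; apply/rowP => i; rewrite !mxE eqY eqZ.
have entryE i f x : f \in B -> x \notin e ->
    edge_entry (fun y => q y 0 i) (merge_endpoints e @: f) (merge_endpoints e x) =
    edge_entry (fun y => plane Y Z y 0 i) f x.
  move=> fB xe; have [y [z [nyz fE]]] := edge_of_pairs sB fB.
  rewrite fE imsetU1 imset_set1 !edge_entry_pair // ?qE.
    by rewrite !merge_eq (negPf xe) !orbF.
  by apply: merge_pair => //; rewrite -fE; apply: contraNneq eB => <-.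
apply: rk_le_dep => c /sum_rows_eq0 c0.
apply/sum_row_mx_eq0; split; apply/sum_masked_eq0 => x; rewrite inE => xe.
  rewrite -[RHS](c0 (merge_endpoints e x) 0); apply: eq_bigr => f fB.
  by rewrite entryE //; congr (_ * _); apply: eq_edge_entry => y; rewrite mxE.
rewrite -[RHS](c0 (merge_endpoints e x) 1); apply: eq_bigr => f fB.
by rewrite entryE //; congr (_ * _); apply: eq_edge_entry => y; rewrite mxE.
Qed.

Lemma rank_inequality (p : V -> 'rV[R]_3) (p2 : V -> 'rV[R]_2)
    (pm : merged_vertices e -> 'rV[R]_2) (B : {set {set V}}) :
  generic p -> generic p2 -> generic pm -> B \subset pairs V -> e \notin B ->
  indep (rigidity_row p) (e |: B) ->
  (2 * #|B| < 2 * rk (fun f : {set V} => rigidity_row pm (merge_endpoints e @: f)) B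
     + rk (rigidity_row p2) (e |: B))%N.
Proof.
move=> gen gen2 genm sB eB iB.
pose X x := p x 0 0.
have nX : X u != X v by apply: generic_coord_neq.
have nXuv : X u - X v != 0 by rewrite subr_eq0.
(* Subtracting this multiple of X gives coordinate i equal values at u and v. The shear is
   invertible, so it preserves dependencies. *)
pose slope (i : 'I_3) := (p u 0 i - p v 0 i) / (X u - X v).
pose shear i x := p x 0 i - slope i * X x.
have shearE i : shear i u = shear i v.
  by apply/eqP; rewrite -subr_eq0 /shear /slope; apply/eqP; field.
pose Y := shear 1; pose Z := shear 2.
have indB : indep (fun f => row_mx (masked_row e X f)
     (row_mx (masked_row e Y f) (masked_row e Z f))) B.
  apply: (indep_masked sB eB nX (shearE 1) (shearE 2)) => c c0; apply: iB.
  apply/sum_rows_eq0 => x i.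
  have shear_entry j f : edge_entry (fun y => p y 0 j) f x =
      edge_entry (shear j) f x + slope j * edge_entry X f x.
    by apply: edge_entry_lin => y; rewrite /shear subrK.
  have step j : (forall y, \sum_(f in e |: B) c f * edge_entry (shear j) f y = 0) ->
      \sum_(f in e |: B) c f * edge_entry (fun y => p y 0 j) f x = 0.
    move=> s0; under eq_bigr do rewrite shear_entry mulrDr [X in _ + X]mulrCA.
    by rewrite big_split /= s0 -mulr_sumr c0 ?mulr0 ?addr0 //; left.
  case: i => -[|[|[|//]]] lti.
  - have -> : Ordinal lti = 0 by apply: val_inj.
    by apply: c0; left.
  - have -> : Ordinal lti = 1 by apply: val_inj.
    by apply: step => y; apply: c0; right; left.
  have -> : Ordinal lti = 2 by apply: val_inj.
  by apply: step => y; apply: c0; right; right.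
(* Multiplied by X u - X v, the difference Y x - Y y becomes a cross product that is nonzero by
   genericity. *)
have nY x y : x != y -> [set x; y] \in B -> Y x != Y y.
  move=> nxy xyB; rewrite -subr_eq0.
  have nset : [set x; y] != e by apply: contraNneq eB => <-.
  have := generic_cross_neq0 gen (isT : 0 != 1 :> 'I_3) nuv nxy nset.
  apply: contra_neq => Yxy0.
  have -> : (p x 0 1 - p y 0 1) * (p u 0 0 - p v 0 0) -
    (p x 0 0 - p y 0 0) * (p u 0 1 - p v 0 1) = (Y x - Y y) * (X u - X v).
    by rewrite /Y /shear /slope /X; field.
  by rewrite Yxy0 mul0r.
have rXY := rk_masked_delete Y gen2 nX eB.
have rYZ := rk_masked_merge genm (shearE 1) (shearE 2) sB eB.
have rX : (rk (masked_row e X) B <= rk (masked_row e Y) B)%N.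
  exact: rk_masked_proportional.
(* With |B| for the full rank, adding |B| + ry <= rxy + ryz and |B| <= rx + ryz, and using rx <= ry,
   gives 2|B| <= rxy + 2 ryz. *)
have h1 := rk_blocks (masked_row e X) (masked_row e Y) (masked_row e Z) B.
have h2 := rk_row_mx (masked_row e X)
  (fun f => row_mx (masked_row e Y f) (masked_row e Z f)) B.
move: h1 h2; rewrite /= (indep_rk indB); move: rXY rYZ rX.
set rx := rk (masked_row e X) B; set ry := rk (masked_row e Y) B.
set rxy := rk _ B; set r2 := rk _ (e |: B); set ryz := rk _ B; set rm := rk _ B.
set nB := #|B|; clearbody rx ry rxy r2 ryz rm nB; lia.
Qed.

End KeyInequality.

(** * Partition of the edges *)

(** A competitor E' is rigid at its own generic p', where it has the rank of the complete graph.
    Both generic placements give the complete graph the same rank, so E' has at least 2|W| - 3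
    edges. *)
Lemma minimally_rigid_plane (R : realType) (W : finType) (p : W -> 'rV[R]_2)
    (u w : W) (E : seq {set W}) :
  generic p -> u != w -> multigraph E -> (size E + 3 = 2 * #|W|)%N ->
  (2 * #|W| <= rk (rigidity_row p) [set f in E] + 3)%N ->
  minimally_rigid R 2 E.
Proof.
move=> gen nuw mE sizeE rkE.
have leK : (rk (rigidity_row p) (pairs W) + 3 <= 2 * #|W|)%N.
  exact: (rk_plane_le (generic_coord_neq _ gen nuw)).
have sEK : [set f in E] \subset pairs W.
  by apply/subsetP => f; rewrite !inE => /(allP mE).
have leE := rkS (rigidity_row p) sEK.
split=> // [|E' mE' [p' gen' /(rigid_rk gen' mE') rkE']].
  exists p => //; apply: rk_rigid => //; lia.
have leE' : (rk (rigidity_row p') [set f in E'] <= size E')%N.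
  by apply: leq_trans (rk_le_card _ _) _; rewrite cardsE card_size.
have leKK : (rk (rigidity_row p) (pairs W) <= rk (rigidity_row p') (pairs W))%N.
  exact: (generic_rk_max p id).
rewrite -rkE' in leKK; rewrite -(leq_add2r 3 (size E)) sizeE.
by rewrite (leq_trans rkE) // leq_add2r (leq_trans leE) // (leq_trans leKK).
Qed.

Lemma card_merged (V : finType) (u v : V) : u != v ->
  (#|merged_vertices [set u; v]| = #|V| - 1)%N.
Proof.
move=> nuv; rewrite card_option card_sig.
have := cardC (mem [set u; v]); rewrite cards2 nuv.
have -> : #|[predC [set u; v]]| = #|[pred x | x \notin [set u; v]]| by apply: eq_card.
by move=> /= <-; lia.
Qed.

(** The merged vertex [None] takes the position of u and that of v is dropped, so no coordinate is
    used twice. *)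
Lemma generic_merged (R : realType) (d : nat) (V : finType) (u v : V)
    (p : V -> 'rV[R]_d) : generic p ->
  generic (fun z : merged_vertices [set u; v] =>
    if z is Some x then p (val x) else p u).
Proof.
pose h (z : merged_vertices [set u; v]) := if z is Some x then val x else u.
apply: (generic_sub (s := fun z => (h z.1, z.2))) => [[y i] [z j]|z i /=]; last first.
  by case: z.
case=> yz ->; congr (_, _); case: y z yz => [x|] [y|] //=.
- by move/val_inj ->.
- by move=> xu; have := valP x; rewrite /= xu !inE eqxx.
- by move=> uy; have := valP y; rewrite /= -uy !inE eqxx.
Qed.

Lemma generic_project (R : realType) (V : finType) (p : V -> 'rV[R]_3) :
  generic p -> generic (fun x => \row_(i < 2) p x 0 (widen_ord (leqnSn 2) i)).
Proof.
apply: (generic_sub (s := fun z => (z.1, widen_ord (leqnSn 2) z.2))) => [|x i].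
  by move=> [x i] [y j] [-> ij]; congr (_, _); apply: val_inj.
by rewrite mxE.
Qed.

(** A basis of the rows of E is already rigid, so by minimality it is all of E. *)
Lemma minimally_rigid_indep (R : realType) (d : nat) (W : finType)
    (E : {set {set W}}) (p : W -> 'rV[R]_d) :
  generic p -> minimally_rigid R d (enum E) -> rigid_framework (enum E) p ->
  indep (rigidity_row p) E.
Proof.
move=> gen [mE _ minE] rig; have := rigid_rk gen mE rig.
have enumE (A : {set {set W}}) : [set f in enum A] = A.
  by apply/setP => f; rewrite !inE mem_enum.
rewrite enumE => rkE; have [B [sBE iB spB]] := exists_basis (rigidity_row p) E.
have mB : multigraph (enum B).
  apply/allP => f; rewrite mem_enum => /(subsetP sBE).
  by rewrite -mem_enum => /(allP mE).
suff <- : B = E by [].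
apply/eqP; rewrite eqEcard sBE !cardE /=; apply: minE => //; exists p => //.
apply: rk_rigid => //; rewrite enumE -rkE; apply/eqP.
by rewrite eqn_leq {1}/rk [in X in _ && X]/rk !mxrankS // rspanS.
Qed.

Lemma minimally_rigid_partition (R : realType) (V : finType) (E : {set {set V}})
    (u v : V) (nuv : u != v) (e := [set u; v]) :
  (3 < #|V|)%N -> minimally_rigid R 3 (enum E) -> e \in E ->
  exists S1 S2 S3 : {set {set V}},
    [/\ S1 :|: S2 :|: S3 = E,
        [/\ [disjoint S1 & S2], [disjoint S1 & S3] & [disjoint S2 & S3]],
        [/\ #|S1| = (#|V| - 1)%N, #|S2| = (#|V| - 2)%N & #|S3| = (#|V| - 3)%N] &
        [/\ minimally_rigid R 2 (enum (S1 :|: S2)),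
            minimally_rigid R 2 (contract (S1 :|: S3) e) &
            minimally_rigid R 2 (contract (S2 :|: S3) e)]].
Proof.
move=> V_gt3 minE eE; have [mE [p gen rig] _] := minE.
have enumE (A : {set {set V}}) : [set f in enum A] = A.
  by apply/setP => f; rewrite !inE mem_enum.
have iE := minimally_rigid_indep gen minE rig.
have sEK : E \subset pairs V.
  by apply/subsetP => f; rewrite -mem_enum inE => /(allP mE).
have geE : (3 * #|V| <= #|E| + 6)%N.
  have /card_gt2P[a [b [c [_ [nab nbc nca]]]]] := ltnW V_gt3.
  rewrite -(indep_rk iE) -{1}(enumE E) (rigid_rk gen mE rig).
  by apply: (@rk_space_ge _ _ _ a b c); rewrite // eq_sym.
pose p2 x : 'rV[R]_2 := \row_i p x 0 (widen_ord (leqnSn 2) i).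
have gen2 : generic p2 by apply: generic_project.
pose pm (z : merged_vertices e) := if z is Some x then p2 (val x) else p2 u.
have genm : generic pm by apply: generic_merged.
pose D := E :\ e.
have sDE : D \subset E by apply: subD1set.
have sDK : D \subset pairs V by apply: subset_trans sEK.
have eD : e \notin D by rewrite !inE eqxx.
have geD : (3 * #|V| <= #|D| + 7)%N.
  by rewrite (leq_trans geE) // (cardsD1 e) eE addnC addnA addnC.
pose rm := rk (fun f : {set V} => rigidity_row pm (merge_endpoints e @: f)).
pose r2 B := rk (rigidity_row p2) (e |: B).
(* A vertex off e provides two distinct merged vertices, as the rank bound in the plane requires. *)
have [w we] : exists w, w \notin e.
  apply/existsP; rewrite -negb_forall; apply/negP => /forallP all_e.
  have : (#|V| <= #|e|)%N by rewrite -cardsT subset_leq_card //; apply/subsetP.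
  by rewrite cards2 nuv leqNgt (ltn_trans _ V_gt3).
have nuw : merge_endpoints e u != merge_endpoints e w.
  rewrite merge_eq (negPf we) andbF orbF.
  by apply: contraNneq we => <-; rewrite !inE eqxx.
have merge_card f : f \in D -> #|merge_endpoints e @: f| == 2%N.
  move=> fD; have [y [z [nyz fE]]] := edge_of_pairs sDK fD.
  rewrite fE imsetU1 imset_set1 cards2 merge_pair //.
  by rewrite -fE; apply: contra eD => /eqP fe; rewrite /e -fe.
have le2 (B : {set {set V}}) : B \subset D -> (r2 B + 3 <= 2 * #|V|)%N.
  move=> sBD; apply: leq_trans (rk_plane_le (generic_coord_neq 0 gen2 nuv)).
  rewrite leq_add2r rkS // subUset sub1set (subsetP sEK) //=.
  exact: subset_trans sDK.
have lem (B : {set {set V}}) : B \subset D -> (rm B + 3 <= 2 * (#|V| - 1))%N.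
  move=> sBD; rewrite -(card_merged nuv).
  apply: leq_trans (rk_plane_le (generic_coord_neq 0 genm nuw)).
  rewrite leq_add2r /rm /rk.
  rewrite -(rspan_imset _ (fun f : {set V} => merge_endpoints e @: f)) mxrankS //.
  apply/rspanS/subsetP => _ /imsetP[f /(subsetP sBD) fD ->].
  by rewrite inE merge_card.
have key (B : {set {set V}}) : B \subset D -> (2 * #|B| < 2 * rm B + r2 B)%N.
  move=> sBD; apply: (rank_inequality nuv gen) => //.
  - exact: subset_trans sDK.
  - by apply: contra eD; apply: (subsetP sBD).
  - apply: indepS iE; rewrite subUset sub1set eE /=.
    exact: subset_trans sDE.
(* Classes 0 and 1 are to have complements spanning for [rm], and class 2 a complement that spans
   for [r2] together with e. *)
pose r (k : 'I_3) := if k == 2 then r2 else rm.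
have [s hs] : exists s : {set V} -> 'I_3,
    forall k, (r k D <= r k (D :\: [set f in D | s f == k]))%N.
  apply: (spanning_partition ord0).
  - move=> k A B; rewrite /r; case: eqP => _; last exact: rk_submod.
    by rewrite /r2 setUUr setUIr rk_submod.
  - move=> k A B; rewrite /r; case: eqP => _; last exact: rkU_le.
    by rewrite /r2 setUA rkU_le.
  have sum3 (F : 'I_3 -> nat) : (\sum_i F i = F 0%R + F 1%R + F 2%R)%N.
    exact: (sum_ord3 F).
  move=> A sAD; rewrite !sum3 /r /=.
  apply: (count_hall V_gt3 geD _ (lem _ (subxx _)) (le2 _ (subxx _))).
    by rewrite -(cardsID A D) (setIidPr sAD).
  exact: key (subsetDl D A).
pose A k := [set f in D | s f == k].
have sAD k : A k \subset D by apply/subsetP => f; rewrite inE => /andP[].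
have disjA j k : j != k -> [disjoint A j & A k].
  move=> njk; apply/pred0P => f /=; rewrite !inE.
  by apply: contraNF njk => /andP[/andP[_ /eqP <-] /andP[_ /eqP <-]].
have coverA : A 0 :|: A 1 :|: A 2 = D.
  apply/setP => f; rewrite !inE -!andb_orr.
  by case: (s f) => -[|[|[|//]]] ? /=; rewrite andbT.
have cardA k : (#|A k| + #|D :\: A k| = #|D|)%N.
  by rewrite -(cardsID (A k) D) (setIidPr (sAD k)).
have cardD3 : (#|A 0%R| + #|A 1%R| + #|A 2%R| = #|D|)%N.
  have dis01 : A 0%R :&: A 1%R = set0 by apply/disjoint_setI0/disjA.
  have dis2 : (A 0%R :|: A 1%R) :&: A 2%R = set0.
    by rewrite setIUl !disjoint_setI0 ?setU0 ?disjA.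
  by rewrite -coverA cardsU dis2 cardsU dis01 !cards0 !subn0.
have leA k : (rk (rigidity_row p2) (e |: (D :\: A k)) <= #|D :\: A k| + 1)%N.
  apply: leq_trans (rk_le_card _ _) _.
  by rewrite cardsU1 !inE eqxx andbF /= addnC.
have leM k : (rm (D :\: A k) <= #|D :\: A k|)%N by apply: rk_le_card.
have := hs 0; have := hs 1; have := hs 2; rewrite /r /= => h2 h1 h0.
have [[c0 c1 c2] [r0 r1 r2A]] :
    [/\ #|A 0%R| = #|V| - 2, #|A 1%R| = #|V| - 2 & #|A 2%R| = #|V| - 3]%N /\
    [/\ 2 * #|V| <= rm (D :\: A 0%R) + 5, 2 * #|V| <= rm (D :\: A 1%R) + 5
      & 2 * #|V| <= r2 (D :\: A 2%R) + 3]%N.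
  apply: (count_sizes V_gt3 geD (lem _ (subxx _)) (le2 _ (subxx _)) (key _ (subxx _))
    cardD3 (cardA 0) (cardA 1) (cardA 2) h0 h1 h2 (leM 0) (leM 1) (leA 2)).
have others k i j : [&& k != i, k != j & i != j] -> D :\: A k = A i :|: A j.
  case/and3P => nki nkj nij; apply/setP => f; rewrite !inE.
  rewrite -andb_orr negb_and andb_orl andNb orFb andbC; congr (_ && _).
  have : [|| s f == k, s f == i | s f == j].
    move: nki nkj nij; move: k i j (s f).
    by do 4!case=> [[|[|[|//]]] ?].
  case: eqP => [->|//]; first by rewrite (negPf nki) (negPf nkj).
have eA k : e \notin A k by apply: contra eD; apply: (subsetP (sAD k)).
have cardDA k : #|D :\: A k| = (#|D| - #|A k|)%N by rewrite -(cardA k) addKn.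
have contract_rigid k (S : {set {set V}}) : S :\ e = D :\: A k ->
    (#|D :\: A k| + 5 = 2 * #|V|)%N -> (2 * #|V| <= rm (D :\: A k) + 5)%N ->
    minimally_rigid R 2 (contract S e).
  move=> SE sizeS rkS; have mergeS : [set f in contract S e] =
      (fun f : {set V} => merge_endpoints e @: f) @: (D :\: A k).
    apply/setP => f; rewrite inE /contract SE; apply/mapP/imsetP => -[g gD ->].
      by exists g; rewrite // -mem_enum.
    by exists g; rewrite // mem_enum.
  apply: (minimally_rigid_plane genm nuw).
  - apply/allP => _ /mapP[f + ->]; rewrite mem_enum SE => /setDP[fD _].
    exact: merge_card.
  - rewrite size_map -cardE SE card_merged //; move: sizeS V_gt3.
    by move: #|D :\: A k| #|V|; clear; lia.
  - rewrite mergeS /rk rspan_imset card_merged //.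
    by move: rkS V_gt3; rewrite /rm /rk; move: (\rank _) #|V|; clear; lia.
have sizeD : (#|D| + 7 = 3 * #|V|)%N.
  move: cardD3; rewrite c0 c1 c2 => <-; move: V_gt3; move: #|V|; clear; lia.
(* The edge e joins class 0. Then S1 and S2 form e with the complement of [A 2] in D, while S1 and
   S3 without e, and S2 and S3, form the complements of [A 1] and [A 0]. *)
exists (e |: A 0), (A 1), (A 2).
have e01 : (e |: A 0) :|: A 1 = e |: (D :\: A 2).
  by rewrite -setUA (others 2 0 1).
split.
- by rewrite e01 -setUA (others 2 0 1) // coverA setD1K.
- split; last exact: disjA.
  + by rewrite -setI_eq0 setIUl setU_eq0 !setI_eq0 disjoints1 eA disjA.
  + by rewrite -setI_eq0 setIUl setU_eq0 !setI_eq0 disjoints1 eA disjA.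
- rewrite cardsU1 eA c0 c1 c2; move: V_gt3; move: #|V|; clear => n n3; split; lia.
split.
- apply: (minimally_rigid_plane gen2 nuv).
  + apply/allP => f; rewrite e01 mem_enum => /setU1P[->|/setDP[fD _]].
      by rewrite cards2 nuv.
    by have := subsetP sDK f fD; rewrite inE.
  + rewrite -cardE e01 cardsU1 !inE eqxx andbF cardDA c2; move: sizeD V_gt3.
    by move: #|D| #|V|; clear; lia.
  + by rewrite enumE e01.
- apply: (contract_rigid 1) => //; last first.
    rewrite cardDA c1; move: sizeD V_gt3.
    by move: #|D| #|V|; clear; lia.
  by rewrite -setUA (others 1 0 2) // setU1K // in_setU (negPf (eA 0)) (negPf (eA 2)).
- apply: (contract_rigid 0) => //; last first.
    rewrite cardDA c0; move: sizeD V_gt3.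
    by move: #|D| #|V|; clear; lia.
  rewrite (others 0 1 2) //; apply/setDidPl.
  by rewrite disjoint_sym disjoints1 in_setU (negPf (eA 1)) (negPf (eA 2)).
Qed.

Local Close Scope ring_scope.

Theorem theorem2 (R : realType) (V : finType) (E : {set {set V}})
    (simpleE : simple_graph E) (V_gt3 : 3 < #|V|)
    (rigidE : minimally_rigid R 3 (spanning_subgraph E))
    (e : {set V}) (eE : e \in E) :
  exists S1 S2 S3 : {set {set V}},
    [/\ S1 :|: S2 :|: S3 = E,
        [/\ [disjoint S1 & S2], [disjoint S1 & S3] & [disjoint S2 & S3]],
        [/\ #|S1| = #|V| - 1, #|S2| = #|V| - 2 & #|S3| = #|V| - 3] &
        [/\ minimally_rigid R 2 (spanning_subgraph (S1 :|: S2)),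
            minimally_rigid R 2 (contract (S1 :|: S3) e) &
            minimally_rigid R 2 (contract (S2 :|: S3) e)]].
Proof.
have /cards2P[u [v [nuv defe]]] : #|e| == 2.
  by apply: (allP simpleE); rewrite mem_enum.
rewrite defe in eE *; exact: minimally_rigid_partition.
Qed.
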